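(* Let $\mathcal Z\subseteq\mathbb R^n$ be a real algebraic variety endowed with $\mathscr L^2$-mollifiers $\{\phi_{z,\epsilon}\}$, $\epsilon\in\mathcal E$, with respect to a reference measure $\lambda$. Let $\mu$ be a finite Borel measure on $\mathcal Z$ whose support $X$ is compact, has nonempty Euclidean interior relative to $\mathcal Z$, and is Zariski dense in $\mathcal Z$, and assume $\mu$ has a continuous, strictly positive density $f$ with respect to $\lambda$ on $X$. Then $$\lim_{\epsilon\to0,\ \epsilon\in\mathcal E}\left(\lim_{d\to\infty}\frac{DMCD^\mu_{d,\epsilon}(x,x)}{\|\phi_{x,\epsilon}\|^2_{\mathscr L^2(\lambda)}}\right)=\begin{cases}1/f(x), & x\in X^\circ,\\ 0, & x\in\mathcal Z\setminus X,\end{cases}$$ where $X^\circ$ is the interior of $X$ relative to $\mathcal Z$.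
   Context: A real algebraic variety is the common real zero set of finitely many real polynomials. $\mathcal Z$ with Borel measure $\lambda$ is endowed with $\mathscr L^2$-mollifiers if there is $\mathcal E\subseteq(0,\infty)$ with $0\in\overline{\mathcal E}$ and functions $\phi_{z,\epsilon}:\mathcal Z\to\mathbb R$ such that: (i) $\phi_{z,\epsilon}\ge0$, $\int_{\mathcal Z}\phi_{z,\epsilon}d\lambda=1$; (ii) for each $\epsilon$ there are $0<c_\epsilon<C_\epsilon$ with $c_\epsilon<\|\phi_{z,\epsilon}\|_{\mathscr L^2(\lambda)}<C_\epsilon$ for all $z$; (iii) $\int\phi_{z,\epsilon}p\,d\lambda\to p(z)$ as $\epsilon\to0$ for continuous $p$; (iv) for every $\delta>0$, $\int_{\mathcal Z\cap\{|y-z|>\delta\}}\phi_{z,\epsilon}^2d\lambda/\|\phi_{z,\epsilon}\|^2_{\mathscr L^2(\lambda)}\to0$ as $\epsilon\to0$. Zariski dense: every polynomial vanishing on $X$ vanishes on $\mathcal Z$. $d\mu=f\,d\lambda$ on $X$. $V_d$ is the space of restrictions to $\mathcal Z$ of real polynomials of degree $\le d$. For $z\in\mathcal Z$, let $\varphi_z\in V_d$ be the unique element with $\int_X\phi_{z,\epsilon}p\,d\lambda=\int_X\varphi_z p\,d\mu$ for all $p\in V_d$; the density-estimator MCD kernel is $DMCD^\mu_{d,\epsilon}(x,y):=\langle\varphi_x,\varphi_y\rangle_{\mathscr L^2(\mu)}$. *)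

(* Defs.v *)
From HB Require Import structures.
From mathcomp Require Import all_boot all_order all_algebra.
From mathcomp Require Import all_classical all_reals all_analysis.

Set Implicit Arguments.
Unset Strict Implicit.
Unset Printing Implicit Defensive.

Import Order.TTheory GRing.Theory Num.Theory.
Import numFieldNormedType.Exports.
Local Open Scope classical_set_scope.
Local Open Scope ring_scope.

Definition Borel (R : realType) (n : nat) := g_sigma_algebraType (@open 'rV[R]_n).

Definition enorm (R : realType) (n : nat) (v : 'rV[R]_n) : R :=
  Num.sqrt (\sum_(i < n) v ord0 i ^+ 2).

Definition poly_deg_le (R : realType) (n d : nat) (P : 'rV[R]_n -> R) : Prop :=
  exists c : {ffun 'I_n -> 'I_d.+1} -> R,
    forall x : 'rV[R]_n,
      P x = \sum_(a : {ffun 'I_n -> 'I_d.+1} | (\sum_(i < n) (a i : nat) <= d)%N)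
              c a * \prod_(i < n) x ord0 i ^+ a i.

Definition is_poly (R : realType) (n : nat) (P : 'rV[R]_n -> R) : Prop :=
  exists d, poly_deg_le d P.

Definition is_variety (R : realType) (n : nat) (Z : set 'rV[R]_n) : Prop :=
  exists (k : nat) (ps : 'I_k -> 'rV[R]_n -> R),
    (forall i, is_poly (ps i)) /\ Z = [set x | forall i, ps i x = 0].

Definition inVd (R : realType) (n : nat) (Z : set 'rV[R]_n) (d : nat)
  (g : 'rV[R]_n -> R) : Prop :=
  exists P : 'rV[R]_n -> R, poly_deg_le d P /\ forall x, Z x -> g x = P x.

Definition zariski_dense (R : realType) (n : nat) (Z X : set 'rV[R]_n) : Prop :=
  forall P : 'rV[R]_n -> R, is_poly P ->
    (forall x, X x -> P x = 0) -> forall x, Z x -> P x = 0.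

Definition rel_interior (R : realType) (n : nat) (Z X : set 'rV[R]_n) : set 'rV[R]_n :=
  [set x | X x /\ exists U : set 'rV[R]_n, [/\ open U, U x & U `&` Z `<=` X]].

Definition msupport (R : realType) (n : nat)
  (mu : {measure set (Borel R n) -> \bar R}) : set 'rV[R]_n :=
  [set x | forall U : set 'rV[R]_n, open U -> U x -> (0 < mu U)%E].

Definition L2norm (R : realType) (n : nat)
  (lam : {measure set (Borel R n) -> \bar R}) (Z : set 'rV[R]_n)
  (g : 'rV[R]_n -> R) : R :=
  Num.sqrt (fine (\int[lam]_(y in Z) ((g y) ^+ 2)%:E)%E).

Definition L2_mollifiers (R : realType) (n : nat)
  (lam : {measure set (Borel R n) -> \bar R}) (Z : set 'rV[R]_n)
  (E : set R) (phi : 'rV[R]_n -> R -> 'rV[R]_n -> R) : Prop :=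
  [/\ E `<=` [set e | 0 < e] /\ closure E 0,
      (forall z eps, Z z -> E eps ->
         [/\ measurable_fun (Z : set (Borel R n)) (phi z eps),
             (forall y, Z y -> 0 <= phi z eps y) &
             (\int[lam]_(y in Z) (phi z eps y)%:E = 1)%E]),
      (forall eps, E eps -> exists c C : R, (0 < c) /\ (c < C) /\
         forall z, Z z ->
           (c < L2norm lam Z (phi z eps)) /\ (L2norm lam Z (phi z eps) < C)),
      (forall z (p : 'rV[R]_n -> R), Z z -> {within Z, continuous p} ->
         (fun eps => (\int[lam]_(y in Z) (phi z eps y * p y)%:E)%E)
           @ within E (nbhs (0 : R)) --> (p z)%:E) &
      (forall z (delta : R), Z z -> 0 < delta ->
         (fun eps =>
            fine (\int[lam]_(y in Z `&` [set y | (delta < enorm (y - z))%R])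
                    ((phi z eps y) ^+ 2)%:E)%E
            / (L2norm lam Z (phi z eps)) ^+ 2)
           @ within E (nbhs (0 : R)) --> (0 : R))].

(* d mu = f d lam on X (mu being concentrated on X). *)
Definition has_density_on (R : realType) (n : nat)
  (lam mu : {measure set (Borel R n) -> \bar R}) (X : set 'rV[R]_n)
  (f : 'rV[R]_n -> R) : Prop :=
  forall A : set (Borel R n), measurable A -> A `<=` X ->
    (mu A = \int[lam]_(y in A) (f y)%:E)%E.

Definition is_dens_rep (R : realType) (n : nat)
  (lam mu : {measure set (Borel R n) -> \bar R}) (Z X : set 'rV[R]_n)
  (phi : 'rV[R]_n -> R -> 'rV[R]_n -> R) (d : nat) (eps : R) (z : 'rV[R]_n)
  (g : 'rV[R]_n -> R) : Prop :=
  inVd Z d g /\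
  forall p : 'rV[R]_n -> R, inVd Z d p ->
    (\int[lam]_(y in (X : set (Borel R n))) (phi z eps y * p y)%:E =
     \int[mu]_(y in (X : set (Borel R n))) (g y * p y)%:E)%E.

(* varphi_z (chosen; it is unique as an element of V_d under the hypotheses
   of the theorem). *)
Definition dens_rep (R : realType) (n : nat)
  (lam mu : {measure set (Borel R n) -> \bar R}) (Z X : set 'rV[R]_n)
  (phi : 'rV[R]_n -> R -> 'rV[R]_n -> R) (d : nat) (eps : R) (z : 'rV[R]_n)
  : 'rV[R]_n -> R :=
  xget (fun _ => 0) (is_dens_rep lam mu Z X phi d eps z).

Definition DMCD (R : realType) (n : nat)
  (lam mu : {measure set (Borel R n) -> \bar R}) (Z X : set 'rV[R]_n)
  (phi : 'rV[R]_n -> R -> 'rV[R]_n -> R) (d : nat) (eps : R)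
  (x y : 'rV[R]_n) : R :=
  fine (\int[mu]_(t in [set: Borel R n])
          (dens_rep lam mu Z X phi d eps x t * dens_rep lam mu Z X phi d eps y t)%:E)%E.

(* Main.v *)
Require Import Defs.
From HB Require Import structures.
From mathcomp Require Import all_boot all_order all_algebra.
From mathcomp Require Import all_classical all_reals all_analysis.
From mathcomp Require Import measurable_realfun ring lra.
Import Order.TTheory GRing.Theory Num.Theory.
Import numFieldNormedType.Exports.
Local Open Scope classical_set_scope.
Local Open Scope ring_scope.

(** On [X] one has [phi dlam = (phi / f) dmu], so the representative of degree
    [d] is the orthogonal projection of [phi / f] onto [V_d] in [L2(mu)].
    Polynomials are dense in [L2(mu)], [mu] being a finite measure with compact
    support, so the squared norms of these projections increase to
    [int_X phi^2 / f dlam].  Divided by [|phi|^2] this is the average of the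
    function equal to [1 / f] on [X] and to [0] elsewhere with respect to the
    probability measure [phi^2 dlam / |phi|^2], which concentrates at the base
    point as [eps] tends to [0]; that function is continuous at the points of
    the interior of [X] and at the points outside [X].

    Density is proved without Stone-Weierstrass: the bounded functions in the
    [L2]-closure of an algebra of bounded functions again form an algebra,
    closed under dominated convergence, so the sets whose indicator lies in the
    closure form a sigma-algebra, and it is enough to reach the half-spaces. *)

Set Implicit Arguments.
Unset Strict Implicit.
Unset Printing Implicit Defensive.

(** * Square-integrable functions *)

Section L2.
Context d (T : measurableType d) (R : realType) (mu : {measure set T -> \bar R}).
Variable (D : set T).
Hypothesis mD : measurable D.
Implicit Types (f g h : T -> R).

Definition sqint f : \bar R := (\int[mu]_(x in D) (f x ^+ 2)%:E)%E.

Definition isL2 f := measurable_fun D f /\ (sqint f < +oo)%E.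

Lemma sqint_ge0 f : (0 <= sqint f)%E.
Proof. by apply: integral_ge0 => x _; rewrite lee_fin sqr_ge0. Qed.

Lemma eq_sqint f g : (forall x, D x -> f x = g x) -> sqint f = sqint g.
Proof. by move=> fg; apply: eq_integral => x; rewrite inE => /fg ->. Qed.

Lemma measurable_sqr f : measurable_fun D f -> measurable_fun D (fun x => (f x ^+ 2)%:E).
Proof. by move=> mf; apply/measurable_EFinP; exact: measurable_funX. Qed.

Lemma le_sqint f g : measurable_fun D f -> measurable_fun D g ->
  (forall x, D x -> f x ^+ 2 <= g x ^+ 2) -> (sqint f <= sqint g)%E.
Proof.
move=> mf mg fg; apply: ge0_le_integral => //=.
- by move=> x _; rewrite lee_fin sqr_ge0.
- exact: measurable_sqr.
- exact: measurable_sqr.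
Qed.

Lemma sqintZ c f : measurable_fun D f ->
  sqint (fun x => c * f x) = ((c ^+ 2)%:E * sqint f)%E.
Proof.
move=> mf; rewrite /sqint -ge0_integralZl_EFin ?sqr_ge0//.
- by apply: eq_integral => x _; rewrite exprMn EFinM.
- by move=> x _; rewrite lee_fin sqr_ge0.
- exact: measurable_sqr.
Qed.

Lemma sqintN f : sqint (fun x => - f x) = sqint f.
Proof. by apply: eq_integral => x _; rewrite sqrrN. Qed.

(** [(a + b)^2 <= 2 (a^2 + b^2)] under the integral: a substitute for the triangle inequality that
    lives in [\bar R] and asks for no finiteness. *)
Lemma sqintD_le f g : measurable_fun D f -> measurable_fun D g ->
  (sqint (fun x => f x + g x)%R <= 2%:E * (sqint f + sqint g))%E.
Proof.
move=> mf mg.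
rewrite /sqint -ge0_integralD//; try exact: measurable_sqr;
  try by move=> x _; rewrite lee_fin sqr_ge0.
rewrite -ge0_integralZl_EFin//; last 2 first.
- by move=> x _; rewrite -EFinD lee_fin addr_ge0// sqr_ge0.
- by apply: emeasurable_funD; exact: measurable_sqr.
apply: ge0_le_integral => //.
- by move=> x _; rewrite lee_fin sqr_ge0.
- by apply: measurable_sqr; exact: measurable_funD.
- by apply: measurable_funeM; apply: emeasurable_funD; exact: measurable_sqr.
move=> x _; rewrite -EFinD -EFinM lee_fin.
have := sqr_ge0 (f x - g x); nra.
Qed.

Lemma isL2D f g : isL2 f -> isL2 g -> isL2 (fun x => f x + g x).
Proof.
move=> [mf Lf] [mg Lg]; split; first exact: measurable_funD.
apply: le_lt_trans (sqintD_le mf mg) _.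
by apply: lte_mul_pinfty => //; apply: lte_add_pinfty.
Qed.

Lemma isL2Z c f : isL2 f -> isL2 (fun x => c * f x).
Proof.
move=> [mf Lf]; split; first by apply: measurable_funM.
by rewrite sqintZ// lte_mul_pinfty ?lee_fin ?sqr_ge0.
Qed.

Lemma isL2N f : isL2 f -> isL2 (fun x => - f x).
Proof.
by move=> [mf Lf]; split; [exact: measurableT_comp|rewrite sqintN].
Qed.

Lemma isL2B f g : isL2 f -> isL2 g -> isL2 (fun x => f x - g x).
Proof. by move=> Lf Lg; apply: isL2D => //; exact: isL2N. Qed.

Lemma isL2_0 : isL2 (fun=> 0).
Proof.
split; first exact: measurable_cst.
rewrite /sqint (eq_integral (cst 0%E)) ?integral0//.
by move=> x _; rewrite expr0n.
Qed.

Lemma isL2_sum (I : Type) (r : seq I) (F : I -> T -> R) :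
  (forall i, isL2 (F i)) -> isL2 (fun x => \sum_(i <- r) F i x).
Proof.
move=> LF; elim: r => [|i r IH].
  by under eq_fun do rewrite big_nil; exact: isL2_0.
by under eq_fun do rewrite big_cons; exact: isL2D.
Qed.

Lemma isL2_mul_bounded f g M : measurable_fun D f ->
  (forall x, D x -> `|f x| <= M) -> isL2 g -> isL2 (fun x => f x * g x).
Proof.
move=> mf fM [mg Lg]; split; first exact: measurable_funM.
apply: le_lt_trans (_ : (sqint (fun x => M * g x)%R < +oo)%E); last first.
  by case: (isL2Z M (conj mg Lg)).
apply: le_sqint.
- exact: measurable_funM.
- exact: measurable_funM.
- move=> x Dx; rewrite !exprMn ler_wpM2r ?sqr_ge0//.
  rewrite -(ger0_norm (sqr_ge0 (f x))) normrX.
  (* No sign is assumed on [M]; it is nonnegative because it bounds [|f x|] at this [x]. *)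
  by rewrite lerXn2r// ?nnegrE// ?fM// (le_trans _ (fM _ Dx)).
Qed.

Lemma sqint_mul_bounded f g M : measurable_fun D f -> measurable_fun D g ->
  (forall x, D x -> `|f x| <= M) ->
  (sqint (fun x => f x * g x)%R <= (M ^+ 2)%:E * sqint g)%E.
Proof.
move=> mf mg fM; rewrite -sqintZ//; apply: le_sqint.
- exact: measurable_funM.
- exact: measurable_funM.
- move=> x Dx; rewrite !exprMn ler_wpM2r ?sqr_ge0//.
  rewrite -(ger0_norm (sqr_ge0 (f x))) normrX.
  by rewrite lerXn2r// ?nnegrE// ?fM// (le_trans _ (fM _ Dx)).
Qed.

Lemma isL2_bounded f M : (mu D < +oo)%E -> measurable_fun D f ->
  (forall x, D x -> `|f x| <= M) -> isL2 f.
Proof.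
move=> muD mf fM.
have L1 : isL2 (fun=> 1).
  split; first exact: measurable_cst.
  rewrite /sqint; under eq_integral do rewrite expr1n.
  by rewrite integral_cst// mul1e.
have [_ h] := isL2_mul_bounded mf fM L1; split => //.
by rewrite (eq_sqint (g := fun x => f x * 1)) // => x _; rewrite mulr1.
Qed.

Lemma L2_integrableM f g : isL2 f -> isL2 g ->
  mu.-integrable D (EFin \o (fun x => f x * g x)).
Proof.
move=> [mf Lf] [mg Lg].
have i2 h : isL2 h -> mu.-integrable D (fun x => (h x ^+ 2)%:E).
  move=> [mh Lh]; apply/integrableP; split; first exact: measurable_sqr.
  by under eq_integral do rewrite gee0_abs ?lee_fin ?sqr_ge0//.
apply: (le_integrable mD _ _ (integrableD mD (i2 _ (conj mf Lf)) (i2 _ (conj mg Lg)))).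
  by apply/measurable_EFinP; exact: measurable_funM.
move=> x Dx /=; rewrite lee_fin [leRHS]ger0_norm ?addr_ge0 ?sqr_ge0//.
have h1 := sqr_ge0 (f x - g x); have h2 := sqr_ge0 (f x + g x).
have h3 := sqr_ge0 (f x); have h4 := sqr_ge0 (g x).
by rewrite ler_norml; apply/andP; split; nra.
Qed.

(** A real number obtained through [fine], hence [0] if the extended integral is infinite; [EFin_ip]
    gives its meaning for square-integrable functions. *)
Definition ip f g : R := (\int[mu]_(x in D) (f x * g x))%R.

Lemma eq_ip f g f' g' : (forall x, D x -> f x = f' x) ->
  (forall x, D x -> g x = g' x) -> ip f g = ip f' g'.
Proof. by move=> e e'; apply: eq_Rintegral => x; rewrite inE => Dx; rewrite e ?e'. Qed.

Lemma EFin_ip f g : isL2 f -> isL2 g ->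
  ((ip f g)%:E = \int[mu]_(x in D) (f x * g x)%:E)%E.
Proof.
by move=> Lf Lg; rewrite /ip /Rintegral fineK// integrable_fin_num//; exact: L2_integrableM.
Qed.

Lemma ipC f g : ip f g = ip g f.
Proof. by apply: eq_Rintegral => x _; rewrite mulrC. Qed.

Lemma ipDl f g h : isL2 f -> isL2 g -> isL2 h ->
  ip (fun x => f x + g x) h = ip f h + ip g h.
Proof.
move=> Lf Lg Lh; rewrite /ip -RintegralD//; try exact: L2_integrableM.
by apply: eq_Rintegral => x _; rewrite mulrDl.
Qed.

Lemma ipZl c f h : isL2 f -> isL2 h -> ip (fun x => c * f x) h = c * ip f h.
Proof.
move=> Lf Lh; rewrite /ip -RintegralZl//; last exact: L2_integrableM.
by apply: eq_Rintegral => x _; rewrite mulrA.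
Qed.

Lemma ipDr f g h : isL2 f -> isL2 g -> isL2 h ->
  ip h (fun x => f x + g x) = ip h f + ip h g.
Proof. by move=> Lf Lg Lh; rewrite ipC ipDl// ipC (ipC g). Qed.

Lemma ipZr c f h : isL2 f -> isL2 h -> ip h (fun x => c * f x) = c * ip h f.
Proof. by move=> Lf Lh; rewrite ipC ipZl// ipC. Qed.

Lemma ipBl f g h : isL2 f -> isL2 g -> isL2 h ->
  ip (fun x => f x - g x) h = ip f h - ip g h.
Proof.
move=> Lf Lg Lh; rewrite ipDl//; last exact: isL2N.
congr (_ + _); rewrite -mulN1r -ipZl//.
by apply: eq_ip => // x _; rewrite mulN1r.
Qed.

Lemma ip_suml (I : Type) (r : seq I) (F : I -> T -> R) h :
  (forall i, isL2 (F i)) -> isL2 h ->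
  ip (fun x => \sum_(i <- r) F i x) h = \sum_(i <- r) ip (F i) h.
Proof.
move=> LF Lh; elim: r => [|i r IH].
  rewrite big_nil (_ : ip _ _ = ip (fun x => 0 * h x) h).
    by rewrite ipZl// mul0r.
  by apply: eq_ip => // x _; rewrite big_nil mul0r.
rewrite big_cons -IH -ipDl//; last exact: isL2_sum.
by apply: eq_ip => // x _; rewrite big_cons.
Qed.

Lemma EFin_ipxx f : isL2 f -> (ip f f)%:E = sqint f.
Proof. by move=> Lf; rewrite EFin_ip//; apply: eq_integral => x _; rewrite expr2. Qed.

Lemma ipxx_ge0 f : 0 <= ip f f.
Proof. by apply: Rintegral_ge0 => x _; rewrite -expr2 sqr_ge0. Qed.

Lemma ip_pythagoras f g : isL2 f -> isL2 g -> ip f g = 0 ->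
  ip (fun x => f x + g x) (fun x => f x + g x) = ip f f + ip g g.
Proof.
move=> Lf Lg fg0; have Lfg := isL2D Lf Lg.
by rewrite ipDl// !ipDr// fg0 (ipC g f) fg0 addr0 add0r.
Qed.

(** The degenerate case of Cauchy-Schwarz, by which a singular Gram matrix still gives solvable
    normal equations in [L2_projection_ord]. *)
Lemma ip_isotropic_eq0 f g : isL2 f -> isL2 g -> ip f f = 0 -> ip g f = 0.
Proof.
move=> Lf Lg ff0.
(* [0 <= |g + t f|^2 = |g|^2 + 2 t <g, f>] for every real [t] *)
have q t : 0 <= ip g g + 2 * t * ip g f.
  have Ltf := isL2Z t Lf.
  have := ipxx_ge0 (fun x => g x + t * f x).
  have L := isL2D Lg Ltf.
  rewrite ipDl// !ipDr// !ipZr// !ipZl// ff0 (ipC f g); lra.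
(* If [ip g f] is not [0], this [t] makes the bound equal to [- ip g g - 2 < 0]. *)
have := q (- (ip g g + 1) / ip g f).
have [//|n0] := eqVneq (ip g f) 0.
rewrite -mulrA divfK//; have := ipxx_ge0 g; lra.
Qed.

End L2.

(** * Density of an algebra of bounded functions *)

Lemma bernoulli_ineq (R : realDomainType) (h : R) (n : nat) :
  -1 <= h -> 1 + n%:R * h <= (1 + h) ^+ n.
Proof.
move=> h1; elim: n => [|n IH]; first by rewrite mul0r addr0 expr0.
have h0 : 0 <= 1 + h by lra.
rewrite exprS; apply: le_trans (ler_wpM2l h0 IH).
have := mulr_ge0 (ler0n R n) (sqr_ge0 h); rewrite -natr1; nra.
Qed.

(** Since [r <= rho^2], the power [r^n] is at most [rho^n rho^n]. Bernoulli for [rho^-1 = 1 + h]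
    bounds [n rho^n] by [h^-1], and the other factor tends to [0]. *)
Lemma cvg_natM_expr (R : realType) (r : R) : 0 <= r < 1 ->
  (fun n => n%:R * r ^+ n) @ \oo --> (0 : R).
Proof.
move=> /andP[r0 r1]; pose rho := (1 + r) / 2; pose h := rho^-1 - 1.
have rho0 : 0 < rho by rewrite /rho; lra.
have rho1 : rho < 1 by rewrite /rho; lra.
have h0 : 0 < h by rewrite /h subr_gt0 invf_gt1.
have rrho : r <= rho ^+ 2.
  by have := sqr_ge0 (1 - r); rewrite /rho; nra.
apply: (@squeeze_cvgr _ _ _ _ (cst 0) (fun n => h^-1 * rho ^+ n)); last 2 first.
- exact: cvg_cst.
- rewrite -[X in _ --> X](mulr0 h^-1); apply: cvgZr.
  by apply: cvg_expr; rewrite gtr0_norm.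
apply: nearW => n; rewrite mulr_ge0 ?exprn_ge0//=.
have rn : r ^+ n <= rho ^+ n * rho ^+ n.
  by rewrite -exprMn -expr2 lerXn2r// nnegrE// sqr_ge0.
apply: le_trans (ler_wpM2l (ler0n R n) rn) _.
rewrite mulrA; apply: ler_wpM2r; first by rewrite exprn_ge0 ?ltW.
rewrite -(ler_pM2r h0) mulVf ?gt_eqF// mulrAC.
have nh : n%:R * h <= rho^-1 ^+ n.
  have -> : rho^-1 = 1 + h by rewrite /h; ring.
  by apply: le_trans (@bernoulli_ineq _ h n _); lra.
apply: le_trans (ler_wpM2r (exprn_ge0 n (ltW rho0)) nh) _.
by rewrite exprVn mulVf// expf_eq0 gt_eqF// andbF.
Qed.

(* The exponent [n * 2 ^ n] is chosen so that the limit at [s = 1/2] itself is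
   [0]; with [2 ^ n] it would be [exp (-1)]. *)
Lemma cvg_step_poly (R : realType) (s : R) : 0 <= s <= 1 ->
  (fun n => (1 - s ^+ n) ^+ (n * 2 ^ n)) @ \oo --> ((s < 2^-1)%R%:R : R).
Proof.
move=> /andP[s0 s1].
have y01 n : 0 <= s ^+ n <= 1 by rewrite exprn_ge0// exprn_ile1.
have Ny n : (n * 2 ^ n)%:R * s ^+ n = n%:R * (2 * s) ^+ n.
  by rewrite exprMn natrM natrX mulrA.
case: ltP => s2 /=.
  (* Bernoulli bounds the power below by [1 - n (2 s)^n], and [2 s < 1] here. *)
  apply: (@squeeze_cvgr _ _ _ _ (fun n => 1 - n%:R * (2 * s) ^+ n) (cst 1)).
  - apply: nearW => n /=; have /andP[y0 y1] := y01 n.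
    rewrite exprn_ile1 ?andbT; [|lra..].
    apply: le_trans (@bernoulli_ineq _ (- s ^+ n) (n * 2 ^ n) _); last by lra.
    by rewrite mulrN Ny.
  - rewrite -[X in _ --> X]subr0; apply: cvgB; first exact: cvg_cst.
    by apply: cvg_natM_expr; lra.
  - exact: cvg_cst.
(* With [y = s^n] and [N] the exponent, [(1 - y)^N (1 + y)^N <= 1], while Bernoulli and [2 s >= 1]
   give [(1 + y)^N >= 1 + n]; hence the bound [1 / (n + 1)], which is [harmonic]. *)
apply: (@squeeze_cvgr _ _ _ _ (cst 0) harmonic).
- apply: nearW => n /=; have /andP[y0 y1] := y01 n.
  rewrite exprn_ge0/=; last by lra.
  have y0' : -1 <= s ^+ n by lra.
  have := bernoulli_ineq (n * 2 ^ n) y0'; rewrite Ny.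
  set q := (1 - _) ^+ _; set q' := (1 + _) ^+ _ => qq'.
  have q0 : 0 <= q by apply: exprn_ge0; lra.
  have : q * q' <= 1.
    by rewrite /q /q' -exprMn exprn_ile1//; nra.
  have : 1 <= (2 * s) ^+ n by apply: exprn_ege1; lra.
  have n0 := ler0n R n.
  move=> z1 qq1; rewrite /harmonic/= -div1r ler_pdivlMr ?ltr0n// -natr1.
  have : 1 + n%:R <= q' by apply: le_trans qq'; nra.
  move=> ?; nra.
- exact: cvg_cst.
- exact: cvg_harmonic.
Qed.

Section L2_closure.
Context d (T : measurableType d) (R : realType) (mu : {measure set T -> \bar R}).
Variable (D : set T).
Hypotheses (mD : measurable D) (muD : (mu D < +oo)%E).
Variable P : set (T -> R).
Hypothesis Pcst : forall c, P (fun=> c).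
Hypothesis PD : forall p q, P p -> P q -> P (fun x => p x + q x).
Hypothesis PM : forall p q, P p -> P q -> P (fun x => p x * q x).
Hypothesis Pmeas : forall p, P p -> measurable_fun D p.
Hypothesis Pbnd : forall p, P p -> exists M : R, forall x, D x -> `|p x| <= M.
Implicit Types f g h : T -> R.

Definition L2approx f := forall e : R, 0 < e ->
  exists2 p, P p & (sqint mu D (fun x => f x - p x)%R < e%:E)%E.

Lemma L2approx_alg p : P p -> L2approx p.
Proof.
move=> Pp e e0; exists p => //; rewrite (@eq_sqint _ _ _ _ _ _ (fun=> 0)).
  rewrite /sqint (eq_integral (cst 0%E)) ?integral0//.
  by move=> x _; rewrite expr0n.
by move=> x _; rewrite subrr.
Qed.

(** Squared norms obey the triangle inequality only up to a factor [2]; this is why errors [e / 4]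
    are requested below. *)
Lemma sqint_tri f g h (a b : R) : measurable_fun D f -> measurable_fun D g ->
  measurable_fun D h ->
  (sqint mu D (fun x => f x - g x)%R < a%:E)%E ->
  (sqint mu D (fun x => g x - h x)%R < b%:E)%E ->
  (sqint mu D (fun x => f x - h x)%R < (2 * (a + b))%:E)%E.
Proof.
move=> mf mg mh fa gb.
have -> : sqint mu D (fun x => f x - h x) =
          sqint mu D (fun x => (f x - g x) + (g x - h x)).
  by apply: eq_sqint => x _; ring.
apply: le_lt_trans (sqintD_le mu mD _ _) _; try exact: measurable_funB.
rewrite EFinM lte_pmul2l ?lte_fin//= EFinD.
by apply: lteD.
Qed.

Lemma L2approx_closed f : measurable_fun D f ->
  (forall e : R, 0 < e -> exists g, [/\ measurable_fun D g, L2approx g &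
     (sqint mu D (fun x => f x - g x)%R < e%:E)%E]) -> L2approx f.
Proof.
move=> mf fP e e0; have e4 : 0 < e / 4 by lra.
have [g [mg ag fg]] := fP _ e4; have [p Pp gp] := ag _ e4.
exists p => //; have := sqint_tri mf mg (Pmeas Pp) fg gp.
by rewrite (_ : 2 * _ = e)//; field.
Qed.

Lemma L2approxD f g : measurable_fun D f -> measurable_fun D g ->
  L2approx f -> L2approx g -> L2approx (fun x => f x + g x).
Proof.
move=> mf mg af ag e e0; have e4 : 0 < e / 4 by lra.
have [p Pp fp] := af _ e4; have [q Pq gq] := ag _ e4.
exists (fun x => p x + q x); first exact: PD.
have mp := Pmeas Pp; have mq := Pmeas Pq.
have := @sqint_tri (fun x => f x + g x) (fun x => p x + g x)
  (fun x => p x + q x) (e / 4) (e / 4).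
rewrite (_ : 2 * _ = e); last by field.
apply; try exact: measurable_funD.
- by rewrite (@eq_sqint _ _ _ _ _ _ (fun x => f x - p x))// => x _; ring.
- by rewrite (@eq_sqint _ _ _ _ _ _ (fun x => g x - q x))// => x _; ring.
Qed.

(** The divisor is [M^2 + 1] rather than [M^2] so as to be positive also for [M = 0]. *)
Lemma sqint_mul_lt f g M (e : R) : measurable_fun D f -> measurable_fun D g ->
  (forall x, D x -> `|f x| <= M) -> 0 < e ->
  (sqint mu D g < (e / (M ^+ 2 + 1))%:E)%E ->
  (sqint mu D (fun x => f x * g x)%R < e%:E)%E.
Proof.
move=> mf mg fM e0 ge.
apply: le_lt_trans (sqint_mul_bounded mu mD mf mg fM) _.
have gfin : sqint mu D g \is a fin_num.
  by rewrite ge0_fin_numE ?sqint_ge0// (lt_trans ge)// ltry.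
have g0 := sqint_ge0 mu D g.
move: ge g0; rewrite -(fineK gfin) -EFinM !lte_fin lee_fin.
have M0 := sqr_ge0 M.
rewrite ltr_pdivlMr; last by lra.
nra.
Qed.

(** [f g - p q = g (f - p) + p (g - q)]. The order of choice matters: [p] comes from the bound [N]
    on [g], and only then is a bound [K] on [p] available to fix the accuracy of [q]. *)
Lemma L2approxM f g (M N : R) : measurable_fun D f -> measurable_fun D g ->
  (forall x, D x -> `|f x| <= M) -> (forall x, D x -> `|g x| <= N) ->
  L2approx f -> L2approx g -> L2approx (fun x => f x * g x).
Proof.
move=> mf mg fM gN af ag e e0; have e4 : 0 < e / 4 by lra.
have [p Pp fp] := af (e / 4 / (N ^+ 2 + 1)) (divr_gt0 e4 (ltr_wpDl (sqr_ge0 _) ltr01)).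
have [K pK] := Pbnd Pp.
have [q Pq gq] := ag (e / 4 / (K ^+ 2 + 1)) (divr_gt0 e4 (ltr_wpDl (sqr_ge0 _) ltr01)).
exists (fun x => p x * q x); first exact: PM.
have mp := Pmeas Pp; have mq := Pmeas Pq.
have := @sqint_tri (fun x => f x * g x) (fun x => p x * g x)
  (fun x => p x * q x) (e / 4) (e / 4).
rewrite (_ : 2 * _ = e); last by field.
apply; try exact: measurable_funM.
- rewrite (@eq_sqint _ _ _ _ _ _ (fun x => g x * (f x - p x))); last by move=> x _; ring.
  by apply: sqint_mul_lt gN _ fp => //; exact: measurable_funB.
- rewrite (@eq_sqint _ _ _ _ _ _ (fun x => p x * (g x - q x))); last by move=> x _; ring.
  by apply: sqint_mul_lt pK _ gq => //; exact: measurable_funB.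
Qed.

Lemma L2approxZ c f (M : R) : measurable_fun D f ->
  (forall x, D x -> `|f x| <= M) ->
  L2approx f -> L2approx (fun x => c * f x).
Proof.
move=> mf fM af.
apply: (@L2approxM (fun=> c) f `|c| M) => //.
exact: L2approx_alg. 
Qed.

(** Dominated convergence for [(f - F n)^2], with dominating function [(2 G)^2], brings some [F n]
    as close to [f] as required; [L2approx_closed] concludes. *)
Lemma L2approx_cvg (F : nat -> T -> R) f G : (forall n, measurable_fun D (F n)) ->
  (forall n, L2approx (F n)) -> measurable_fun D f -> isL2 mu D G ->
  (forall n x, D x -> `|F n x| <= G x) -> (forall x, D x -> `|f x| <= G x) ->
  (forall x, D x -> F n x @[n --> \oo] --> f x) -> L2approx f.
Proof.
move=> mF aF mf LG FG fG Ff; apply: L2approx_closed => // e e0.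
have mFf n : measurable_fun D (fun x => f x - F n x) by exact: measurable_funB.
have : (sqint mu D (fun x => f x - F n x)%R @[n --> \oo] --> 0)%E.
  have LG2 := isL2Z mD 2 LG.
  have iG := L2_integrableM mD LG2 LG2.
  have cvg0 : {ae mu, forall x, D x ->
      ((f x - F n x) ^+ 2)%:E @[n --> \oo] --> (cst 0%E x : \bar R)}.
    apply: aeW => x Dx; apply: cvg_EFin; first exact: nearW.
    have : (f x - F n x) * (f x - F n x) @[n --> \oo] --> (f x - f x) * (f x - f x).
      by apply: cvgM; apply: cvgB; (exact: cvg_cst || exact: Ff).
    by rewrite subrr mulr0.
  have dom : {ae mu, forall x n, D x ->
      (`|((f x - F n x) ^+ 2)%:E| <= (EFin \o (fun x => (2 * G x) * (2 * G x))%R) x)%E}.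
    apply: aeW => x n Dx /=; rewrite lee_fin ger0_norm ?sqr_ge0// -expr2.
    rewrite -[leLHS]ger0_norm ?sqr_ge0// normrX lerXn2r ?nnegrE//.
      by rewrite mulr_ge0// (le_trans _ (fG x Dx)).
    rewrite (le_trans (ler_normB _ _))//.
    by have := FG n x Dx; have := fG x Dx; lra.
  have [_ _] := dominated_convergence mD (fun n => measurable_sqr (mFf n))
    (measurable_cst _) cvg0 iG dom.
  by rewrite integral0.
move=> /(_ [set y | (y < e%:E)%E]); case.
  by apply: open_ereal_lt'; rewrite lte_fin.
by move=> N _ /(_ N (leqnn N)) FN; exists (F N).
Qed.

Lemma L2approx_sum (I : Type) (r : seq I) (F : I -> T -> R) :
  (forall i, measurable_fun D (F i)) -> (forall i, L2approx (F i)) ->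
  L2approx (fun x => \sum_(i <- r) F i x).
Proof.
move=> mF aF; elim: r => [|i r IH].
  under eq_fun do rewrite big_nil.
  exact: L2approx_alg.
under eq_fun do rewrite big_cons.
by apply: L2approxD => //; exact: measurable_sum.
Qed.

Definition L2approx_set (B : set T) := measurable B /\ L2approx \1_B.

Lemma normr_indic_le1 (B : set T) x : `|\1_B x| <= 1 :> R.
Proof. by rewrite indicE; case: (x \in B); rewrite ?normr1 ?normr0. Qed.

Lemma L2approx_setC B : L2approx_set B -> L2approx_set (~` B).
Proof.
move=> [mB aB]; split; first exact: measurableC.
have mi : measurable_fun D (\1_B : T -> R) by exact: measurable_indic.
have -> : (\1_(~` B) : T -> R) = fun x => 1 + (-1) * \1_B x.
  by apply/funext => x; rewrite indicC indicE; case: (x \in B) => /=; ring.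
apply: L2approxD => //.
- exact: measurable_funM.
- exact: L2approx_alg.
- by apply: (@L2approxZ (-1) _ 1) => // x _; exact: normr_indic_le1.
Qed.

Lemma L2approx_setI A B : L2approx_set A -> L2approx_set B -> L2approx_set (A `&` B).
Proof.
move=> [mA aA] [mB aB]; split; first exact: measurableI.
rewrite indicI; apply: (@L2approxM _ _ 1 1) => //;
  try exact: measurable_indic; by move=> x _; exact: normr_indic_le1.
Qed.

Lemma L2approx_setU A B : L2approx_set A -> L2approx_set B -> L2approx_set (A `|` B).
Proof.
move=> aA aB; rewrite -(setCK (A `|` B)) setCU.
by apply/L2approx_setC/L2approx_setI; exact: L2approx_setC.
Qed.

Lemma L2approx_set0 : L2approx_set set0.
Proof. by split => //; rewrite indic0; exact: (L2approx_alg (Pcst 0)). Qed.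

Lemma isL2_1 : isL2 mu D (fun=> 1).
Proof.
by apply: (@isL2_bounded _ _ _ _ _ mD _ 1) => // x _; rewrite normr1.
Qed.

(** The indicators of the finite unions converge pointwise and are dominated by the constant [1],
    which is square-integrable because [mu D] is finite. *)
Lemma L2approx_bigcup (F : nat -> set T) : (forall n, L2approx_set (F n)) ->
  L2approx_set (\bigcup_n F n).
Proof.
move=> aF; pose U n := \big[setU/set0]_(i < n) F i.
have aU n : L2approx_set (U n).
  rewrite /U; elim: n => [|n IH]; first by rewrite big_ord0; exact: L2approx_set0.
  by rewrite big_ord_recr; exact: L2approx_setU.
have mF : measurable (\bigcup_n F n) by apply: bigcupT_measurable => n; case: (aF n).
split => //.
apply: (@L2approx_cvg (fun n => \1_(U n)) _ (fun=> 1)) => //.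
- by move=> n; apply: measurable_indic; case: (aU n).
- by move=> n; case: (aU n).
- exact: isL2_1.
- by move=> n x _; exact: normr_indic_le1.
- by move=> x _; exact: normr_indic_le1.
move=> x _; have [[k _ Fkx]|nF] := pselect ((\bigcup_n F n) x).
  apply: cvg_near_cst; exists k.+1 => // n /= kn.
  rewrite !indicE !mem_set//; first by exists k.
  by rewrite /U -bigcup_mkord; exists k.
apply: cvg_near_cst; apply: nearW => n; rewrite !indicE !memNset//.
by rewrite /U -bigcup_mkord => -[k _ Fkx]; apply: nF; exists k.
Qed.

Lemma L2approx_generated (G : set (set T)) :
  G `<=` L2approx_set -> <<s G >> `<=` L2approx_set.
Proof.
apply: smallest_sub; split.
- exact: L2approx_set0.
- by move=> A; rewrite setTD; exact: L2approx_setC.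
- exact: L2approx_bigcup.
Qed.

Import HBNNSimple.

(** Simple functions are finite combinations of indicators; the increasing ones that approximate [f]
    are dominated by [f] itself. *)
Lemma L2approx_ge0 f : (forall B, measurable B -> L2approx \1_B) ->
  isL2 mu D f -> (forall x, D x -> 0 <= f x) -> L2approx f.
Proof.
move=> aB Lf f0; have [mf _] := Lf.
have mf' : measurable_fun D (EFin \o f) by exact/measurable_EFinP.
have f0' x : D x -> (0 <= (EFin \o f) x)%E by move=> Dx; rewrite lee_fin f0.
pose g n : T -> R := nnsfun_approx mD mf' n.
have cg x : D x -> g n x @[n --> \oo] --> f x.
  by move=> Dx; apply: (fine_cvg (cvg_nnsfun_approx mD mf' f0' Dx)).
have gf n x : D x -> g n x <= f x.
  move=> Dx; have /cvg_lim <- // := cg x Dx.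
  apply: nondecreasing_cvgn_le; last by apply/cvg_ex; exists (f x); exact: cg.
  by move=> i j ij; apply/lefP/nd_nnsfun_approx.
have mg n : measurable_fun D (g n) by exact: measurable_funTS.
have gn0 n x : 0 <= g n x by rewrite /g; exact: fun_ge0.
apply: (@L2approx_cvg g f f) => //.
- move=> n; have [r ->] : exists r : seq R, g n = fun x =>
      \sum_(y <- r) y * \1_(g n @^-1` [set y]) x.
    eexists; apply/funext => x; rewrite {1}/g fimfunE fsbig_finite//=; reflexivity.
  apply: L2approx_sum => y.
    by apply: measurable_funM => //; apply: measurable_indic; exact: measurable_sfunP.
  apply: (@L2approxZ y _ 1).
  + by apply: measurable_indic; exact: measurable_sfunP.
  + by move=> x _; exact: normr_indic_le1.
  + by apply: aB; exact: measurable_sfunP.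
- by move=> n x Dx; rewrite ger0_norm// gf.
- by move=> x Dx; rewrite ger0_norm// f0.
Qed.

(** An affine change of [u] sends [D] into [[0, 1]] and the level [t] to [1/2]. The polynomials of
    [cvg_step_poly] in it lie in [P] and converge on [D] to the indicator; their limit at the level
    itself is [0], as the strict inequality demands. *)
Lemma L2approx_lt u (t : R) : P u -> measurable [set x | u x < t] ->
  L2approx_set [set x | u x < t].
Proof.
move=> Pu mut; split => //; have [M uM] : exists M : R, forall x, D x -> `|u x| <= M := Pbnd Pu.
(* [|u - t| <= K] on [D], so that [s] below stays within [1/2] of [1/2]; the [+ 1] makes [K]
   positive. *)
pose K := `|M| + `|t| + 1.
have K0 : 0 < K by rewrite /K ltr_wpDl// addr_ge0.
pose s x := (2 * K)^-1 * u x + (2^-1 - (2 * K)^-1 * t).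
have sE x : s x = (2 * K)^-1 * (u x - t) + 2^-1 by rewrite /s; ring.
have K2 : 0 < (2 * K)^-1 by rewrite invr_gt0 mulr_gt0.
have s01 x : D x -> 0 <= s x <= 1.
  move=> Dx; rewrite sE.
  have : `|(2 * K)^-1 * (u x - t)| <= 2^-1.
    rewrite normrM gtr0_norm// invfM -mulrA -[leRHS]mulr1 ler_wpM2l ?invr_ge0//.
    rewrite mulrC ler_pdivrMr// mul1r (le_trans (ler_normB _ _))//.
    have := uM x Dx; have := ler_norm M; rewrite /K; lra.
  by rewrite ler_norml => /andP[]; lra.
have Ps : P s by apply: PD => //; apply: PM.
have PX p n : P p -> P (fun x => p x ^+ n).
  move=> Pp; elim: n => [|n IH]; first by under eq_fun do rewrite expr0.
  by under eq_fun do rewrite exprS; exact: PM.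
(* The difference is written with [(-1) *] because [P] is given as containing the constants and
   stable under sums and products. *)
pose F n x := (1 + (-1) * s x ^+ n) ^+ (n * 2 ^ n).
have PF n : P (F n) by apply/PX/PD => //; apply/PM => //; exact: PX.
apply: (@L2approx_cvg F _ (fun=> 1)) => //.
- by move=> n; exact: Pmeas.
- by move=> n; exact: L2approx_alg.
- exact: isL2_1.
- move=> n x Dx; have /andP[s0 s1] := s01 x Dx.
  have : 0 <= s x ^+ n <= 1 by rewrite exprn_ge0 ?exprn_ile1.
  move=> /andP[y0 y1].
  by rewrite /F normrX exprn_ile1// ler_norml; lra.
- by move=> x _; exact: normr_indic_le1.
move=> x Dx.
have -> : \1_[set x | u x < t] x = (s x < 2^-1)%R%:R :> R.
  rewrite indicE; congr (_%:R); congr nat_of_bool.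
  rewrite sE gtrDr pmulr_rlt0// subr_lt0.
  by apply/idP/idP; rewrite inE.
have := cvg_step_poly (s01 x Dx); rewrite /F.
by under eq_fun do rewrite -mulN1r.
Qed.

End L2_closure.

(** * Change of reference measure and orthogonal projection *)

Section density.
Context d (T : measurableType d) (R : realType).
Variables (mu lam : {measure set T -> \bar R}) (D : set T) (f : T -> R).
Hypotheses (mD : measurable D) (mf : measurable_fun D f).
Hypothesis f0 : forall x, D x -> 0 <= f x.
Hypothesis muf : forall A, measurable A -> A `<=` D ->
  (mu A = \int[lam]_(y in A) (f y)%:E)%E.
Implicit Types h : T -> R.

Import HBNNSimple.

Lemma integral_density_nnsfun (h : {nnsfun T >-> R}) :
  (\int[mu]_(x in D) (h x)%:E = \int[lam]_(x in D) (h x * f x)%:E)%E.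
Proof.
have [r [r0 hE]] : exists r : seq R, (forall y, y \in r -> 0 <= y) /\
    forall x, h x = \sum_(y <- r) y * \1_(h @^-1` [set y]) x.
  eexists; split; last by move=> x; rewrite fimfunE fsbig_finite//=; reflexivity.
  by move=> y; rewrite in_fset_set// inE => -[x _ <-].
have mh y : measurable (h @^-1` [set y]) by exact: measurable_sfunP.
have mi y : measurable_fun D (\1_(h @^-1` [set y]) : T -> R) by exact: measurable_indic.
(* Integrating a finite sum termwise asks for nonnegative summands at every index [y], also outside
   [r]; truncating the coefficient at [0] changes nothing on [r]. *)
have pos y : 0 <= Num.max 0 y :> R by rewrite le_max lexx.
have hE' x : (h x)%:E =
    (\sum_(y <- r) (Num.max 0 y * \1_(h @^-1` [set y]) x)%:E)%E.
  by rewrite sumEFin hE; congr EFin; apply: eq_big_seq => y /r0 y0; rewrite max_r.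
have hfE x : (h x * f x)%:E =
    (\sum_(y <- r) (Num.max 0 y * (\1_(h @^-1` [set y]) x * f x))%:E)%E.
  rewrite sumEFin hE mulr_suml; congr EFin.
  by apply: eq_big_seq => y /r0 y0; rewrite max_r// mulrA.
under eq_integral do rewrite hE'.
under [RHS]eq_integral do rewrite hfE.
have i0 (y : R) x : 0 <= \1_(h @^-1` [set y]) x :> R by [].
rewrite ge0_integral_sum//; last 2 first.
- by move=> y; apply/measurable_EFinP; exact: measurable_funM.
- by move=> y x _; rewrite lee_fin mulr_ge0.
rewrite ge0_integral_sum//; last 2 first.
- by move=> y; apply/measurable_EFinP; do 2 apply: measurable_funM => //.
- by move=> y x Dx; rewrite lee_fin mulr_ge0// mulr_ge0// f0.
apply: eq_bigr => y _.
under eq_integral do rewrite EFinM.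
under [RHS]eq_integral do rewrite EFinM.
rewrite !ge0_integralZl_EFin//; last 3 first.
- by move=> x Dx; rewrite lee_fin mulr_ge0// f0.
- by apply/measurable_EFinP; exact: measurable_funM.
- by apply/measurable_EFinP.
congr (_ * _)%E; rewrite integral_indic// muf//; last exact: measurableI.
rewrite setIC integral_mkcondr; apply: eq_integral => x _.
by rewrite /patch indicE; case: ifPn => _ /=; rewrite ?mul1r ?mul0r.
Qed.

Lemma ge0_integral_density h : measurable_fun D h -> (forall x, D x -> 0 <= h x) ->
  (\int[mu]_(x in D) (h x)%:E = \int[lam]_(x in D) (h x * f x)%:E)%E.
Proof.
move=> mh h0.
have mh' : measurable_fun D (EFin \o h) by exact/measurable_EFinP.
have h0' x : D x -> (0 <= (EFin \o h) x)%E by move=> Dx; rewrite lee_fin h0.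
pose g n : T -> R := nnsfun_approx mD mh' n.
have cg x : D x -> (g n x)%:E @[n --> \oo] --> (h x)%:E.
  by move=> Dx; exact: (cvg_nnsfun_approx mD mh' h0' Dx).
have mg n : measurable_fun D (g n) by exact: measurable_funTS.
have gn0 n x : 0 <= g n x by rewrite /g; exact: fun_ge0.
have ndg x m k : (m <= k)%N -> g m x <= g k x.
  by move=> mk; apply/lefP/nd_nnsfun_approx.
transitivity (limn (fun n => \int[mu]_(x in D) (g n x)%:E))%E.
  rewrite -monotone_convergence//.
  - by apply: eq_integral => x; rewrite inE => Dx; apply/esym/cvg_lim => //; exact: cg.
  - by move=> n; apply/measurable_EFinP.
  - by move=> n x _; rewrite lee_fin.
  - by move=> x _ m k mk; rewrite lee_fin ndg.
rewrite (_ : (fun n => _) = (fun n => \int[lam]_(x in D) (g n x * f x)%:E)%E); last first.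
  by apply/funext => n; exact: integral_density_nnsfun.
rewrite -monotone_convergence//.
- apply: eq_integral => x; rewrite inE => Dx; apply/cvg_lim => //.
  under eq_fun do rewrite EFinM; rewrite EFinM.
  by apply: cvgeZr => //; exact: cg.
- by move=> n; apply/measurable_EFinP; exact: measurable_funM.
- by move=> n x Dx; rewrite lee_fin mulr_ge0// f0.
- by move=> x Dx m k mk; rewrite lee_fin ler_wpM2r ?f0// ndg.
Qed.

(** As [f >= 0] on [D], the positive and negative parts of [h f] are those of [h] times [f], so the
    nonnegative case applies to each and the two differences agree even when infinite. *)
Lemma integral_density h : measurable_fun D h ->
  (\int[mu]_(x in D) (h x)%:E = \int[lam]_(x in D) (h x * f x)%:E)%E.
Proof.
move=> mh; rewrite integralE [RHS]integralE.
congr (_ - _)%E.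
- transitivity (\int[mu]_(x in D) (Num.max (h x) 0)%:E)%E.
    by apply: eq_integral => x _; rewrite funeposE EFin_max.
  rewrite ge0_integral_density; first last.
  + by move=> x _; rewrite le_max lexx orbT.
  + by apply: measurable_maxr.
  apply: eq_integral => x; rewrite inE => Dx.
  by rewrite funeposE -EFin_max maxr_pMl ?f0// mul0r.
- transitivity (\int[mu]_(x in D) (Num.max (- h x) 0)%:E)%E.
    by apply: eq_integral => x _; rewrite funenegE EFin_max.
  rewrite ge0_integral_density; first last.
  + by move=> x _; rewrite le_max lexx orbT.
  + by apply: measurable_maxr => //; exact: measurableT_comp.
  apply: eq_integral => x; rewrite inE => Dx.
  by rewrite funenegE -EFinN -EFin_max maxr_pMl ?f0// mul0r mulNr.
Qed.

End density.

(** The Fredholm alternative: [G] annihilates the columns of [cokermx G], and [b] lies in the row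
    space of [G] as soon as it annihilates them too. *)
Lemma mulmx_solvable (F : fieldType) (m : nat) (G : 'M[F]_m) (b : 'rV[F]_m) :
  (forall w : 'cV[F]_m, G *m w = 0 -> b *m w = 0) -> exists c, c *m G = b.
Proof.
move=> Gb; suff /submxP[c ->] : (b <= G)%MS by exists c.
rewrite submxE; apply/eqP/matrixP => i j.
have := Gb (col j (cokermx G)); rewrite colE (mulmxA G) mulmx_coker mul0mx.
by move=> /(_ erefl)/matrixP/(_ i ord0); rewrite mulmxA -colE !mxE.
Qed.

Section projection.
Context d (T : measurableType d) (R : realType) (mu : {measure set T -> \bar R}).
Variables (D : set T) (mD : measurable D).
Notation ip := (ip mu D).
Notation isL2 := (isL2 mu D).

(** These are the normal equations for the Gram matrix [G], which is singular if the [e i] are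
    dependent in [L2(mu)]. They are solvable all the same: [G w = 0] makes the combination of the
    [e i] with coefficients [w] a function of norm [0], hence orthogonal to [psi]. *)
Lemma L2_projection_ord (m : nat) (e : 'I_m -> T -> R) (psi : T -> R) :
  (forall i, isL2 (e i)) -> isL2 psi ->
  exists c : 'I_m -> R, forall k,
    ip (fun x => \sum_i c i * e i x) (e k) = ip psi (e k).
Proof.
move=> Le Lpsi.
pose G := \matrix_(i, j) ip (e i) (e j); pose b := \row_j ip psi (e j).
have Lsum w : isL2 (fun x => \sum_i w i * e i x).
  by apply: isL2_sum => // i; exact: isL2Z.
have ip_sum h w : isL2 h -> ip h (fun x => \sum_i w i * e i x) = \sum_i ip h (e i) * w i.
  move=> Lh; rewrite ipC ip_suml//; last by move=> i; exact: isL2Z.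
  by apply: eq_bigr => i _; rewrite ipZl// mulrC ipC.
have [w Gw|c cG] := @mulmx_solvable _ _ G b.
  have e_orth i : ip (e i) (fun x => \sum_j w j ord0 * e j x) = 0.
    rewrite ip_sum//; have /matrixP/(_ i ord0) := Gw.
    rewrite !mxE => Gw0; rewrite -[RHS]Gw0.
    by under [RHS]eq_bigr do rewrite mxE.
  apply/matrixP => i j; rewrite (ord1 i) (ord1 j) !mxE.
  transitivity (ip psi (fun x => \sum_j w j ord0 * e j x)).
    by rewrite ip_sum//; apply: eq_bigr => k _; rewrite mxE.
  apply: ip_isotropic_eq0 => //.
  by rewrite ip_sum// big1// => k _; rewrite ipC e_orth mul0r.
exists (c ord0) => k; have /matrixP/(_ ord0 k) := cG; rewrite !mxE => <-.
rewrite ip_suml//; last by move=> i; exact: isL2Z.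
by apply: eq_bigr => i _; rewrite ipZl// mxE.
Qed.

Lemma L2_projection (I : finType) (e : I -> T -> R) (psi : T -> R) :
  (forall i, isL2 (e i)) -> isL2 psi ->
  exists c : I -> R, forall k,
    ip (fun x => \sum_i c i * e i x) (e k) = ip psi (e k).
Proof.
move=> Le Lpsi.
have [c cP] := @L2_projection_ord #|I| (fun i => e (enum_val i)) psi (fun i => Le _) Lpsi.
exists (fun i => c (enum_rank i)) => k.
rewrite -(enum_rankK k) -cP; apply: eq_ip => // x _.
rewrite (reindex (@enum_val I I)) /=; last first.
  by exists enum_rank => i _; [exact: enum_valK|exact: enum_rankK].
by apply: eq_bigr => i _; rewrite enum_valK.
Qed.

End projection.

(** * Borel sets and polynomial functions on R^n *)

Section borel.
Context (R : realType) (n : nat).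

Lemma Borel_open (U : set 'rV[R]_n) : open U -> measurable (U : set (Borel R n)).
Proof. exact: sub_sigma_algebra. Qed.

Lemma Borel_closed (U : set 'rV[R]_n) : closed U -> measurable (U : set (Borel R n)).
Proof.
by move=> cU; rewrite -(setCK U); apply: measurableC; apply: Borel_open; exact: closed_openC.
Qed.

Lemma within_continuous_measurable (X : set 'rV[R]_n) (f : 'rV[R]_n -> R) :
  closed X -> {within X, continuous f} ->
  measurable_fun (X : set (Borel R n)) (f : Borel R n -> R).
Proof.
move=> cX /continuousP cf.
apply: (measurability _ (RGenOpens.measurableE R)).
move=> _ [_ [a [b ->] <-]].
have oab : open (`]a, b[%classic : set R) by exact: interval_open.
have /open_subspaceP[V oV VX] := cf _ oab.
by rewrite setIC -VX; apply: measurableI; [exact: Borel_open|exact: Borel_closed].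
Qed.

Lemma continuous_Borel_measurable (f : 'rV[R]_n -> R) : continuous f ->
  measurable_fun [set: Borel R n] (f : Borel R n -> R).
Proof.
by move=> cf; apply: within_continuous_measurable; [exact: closedT|exact: continuous_subspaceT].
Qed.

(** A countable base of the topology. It serves twice: to build open sets from half-spaces, and to
    cover the complement of a support by null sets. *)
Definition rat_box (p : 'rV[rat]_n * 'rV[rat]_n) : set 'rV[R]_n :=
  [set x | forall j, ratr (p.1 ord0 j) < x ord0 j < ratr (p.2 ord0 j)].

Lemma open_rat_box (U : set 'rV[R]_n) x : open U -> U x ->
  exists p, rat_box p x /\ rat_box p `<=` U.
Proof.
move=> oU Ux; have : nbhs x U by exact: open_nbhs_nbhs.
move=> [Q Qx QU].
have ab j : exists ab : rat * rat, ratr ab.1 < x ord0 j < ratr ab.2 /\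
    [set y : R | ratr ab.1 < y < ratr ab.2] `<=` Q ord0 j.
  have /nbhs_ballP[e /= e0 eQ] := Qx ord0 j.
  have [a] := @rat_in_itvoo R (x ord0 j - e) (x ord0 j) (ltac:(lra)).
  rewrite in_itv/= => /andP[a1 a2].
  have [b] := @rat_in_itvoo R (x ord0 j) (x ord0 j + e) (ltac:(lra)).
  rewrite in_itv/= => /andP[b1 b2].
  exists (a, b); rewrite /= a2 b1; split => // y /= /andP[ay yb]; apply: eQ.
  by rewrite /ball/= ltr_norml; lra.
have [g gP] := choice ab.
exists (\row_j (g j).1, \row_j (g j).2); split.
  by move=> j; rewrite !mxE; case: (gP j).
move=> y yp; apply: QU => i j; rewrite (ord1 i); case: (gP j) => _; apply.
by have := yp j; rewrite !mxE.
Qed.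

(** Each natural number codes at most one pair of rational corners; numbers that code none, or a box
    not inside [U], contribute [set0]. *)
Lemma open_bigcup_rat_box (U : set 'rV[R]_n) : open U ->
  U = \bigcup_k (if @unpickle ('rV[rat]_n * 'rV[rat]_n)%type k is Some p then
         (if `[< rat_box p `<=` U >] then rat_box p else set0) else set0).
Proof.
move=> oU; apply/seteqP; split => [x Ux|x [k _]].
  have [p [px pU]] := open_rat_box oU Ux.
  by exists (pickle p) => //; rewrite pickleK asboolT.
by case: unpickle => // p; case: asboolP => // pU /pU.
Qed.

(** Each face is put in the form [u x < t] with [u] polynomial, the form treated by
    [L2approx_lt]. *)
Lemma rat_boxE p : rat_box p =
  \big[setI/setT]_(j < n) ([set x : 'rV[R]_n | x ord0 j < ratr (p.2 ord0 j)] `&`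
                         [set x : 'rV[R]_n | -1 * x ord0 j < - ratr (p.1 ord0 j)]).
Proof.
rewrite -bigcap_seq; apply/seteqP; split => [x px j _ /=|x px j].
  by have /andP[? ?] := px j; split => //; lra.
have [|/= -> ?] := px j; first by rewrite /= mem_index_enum.
rewrite andbT; lra.
Qed.

Lemma measurable_coord (j : 'I_n) :
  measurable_fun [set: Borel R n] ((fun x : 'rV[R]_n => x ord0 j) : Borel R n -> R).
Proof. by apply: continuous_Borel_measurable; exact: coord_continuous. Qed.

End borel.

(** * Polynomial functions and their density in [L2(mu)] *)

Section polynomial_functions.
Context (R : realType) (n : nat).
Implicit Types r : seq (R * {ffun 'I_n -> nat}).

(** Lists of coefficients and exponents, with no degree bound in the type: sums are concatenations
    and products are lists of pairs. [is_poly_funs] and [poly_fun_deg_le] link them to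
    [poly_deg_le]. *)
Definition poly_fun r (x : 'rV[R]_n) : R :=
  \sum_(m <- r) m.1 * \prod_j x ord0 j ^+ m.2 j.

Definition poly_funs : set ('rV[R]_n -> R) := range poly_fun.

Lemma poly_funs_cst c : poly_funs (fun=> c).
Proof.
exists [:: (c, [ffun=> 0%N])] => //; apply/funext => x.
rewrite /poly_fun big_seq1 big1 ?mulr1// => j _.
by rewrite ffunE expr0.
Qed.

Lemma poly_funsD p q : poly_funs p -> poly_funs q -> poly_funs (fun x => p x + q x).
Proof.
move=> [r _ <-] [r' _ <-]; exists (r ++ r') => //.
by apply/funext => x; rewrite /poly_fun big_cat.
Qed.

Lemma poly_funsM p q : poly_funs p -> poly_funs q -> poly_funs (fun x => p x * q x).
Proof.
move=> [r _ <-] [r' _ <-].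
pose mulm (m m' : R * {ffun 'I_n -> nat}) :=
  (m.1 * m'.1, [ffun j => (m.2 j + m'.2 j)%N] : {ffun 'I_n -> nat}).
exists [seq mulm m m' | m <- r, m' <- r'] => //.
apply/funext => x; rewrite /poly_fun big_allpairs_dep mulr_suml.
apply: eq_bigr => m _; rewrite mulr_sumr; apply: eq_bigr => m' _ /=.
rewrite mulrACA -big_split/=; congr (_ * _); apply: eq_bigr => j _.
by rewrite ffunE exprD.
Qed.

Lemma poly_funs_coord j : poly_funs (fun x => x ord0 j).
Proof.
exists [:: (1, [ffun i => (i == j) : nat])] => //; apply/funext => x.
rewrite /poly_fun big_seq1 mul1r (bigD1 j)//= ffunE eqxx expr1 big1 ?mulr1// => i ij.
by rewrite ffunE (negbTE ij) expr0.
Qed.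

Lemma measurable_poly_funs (X : set (Borel R n)) p : poly_funs p ->
  measurable_fun X (p : Borel R n -> R).
Proof.
move=> [r _ <-]; apply: measurable_funTS; apply: measurable_sum => m.
apply: measurable_funM => //; apply: measurable_prod => j _.
by apply: measurable_funX; exact: measurable_coord.
Qed.

Lemma poly_funs_bounded (X : set 'rV[R]_n) p : compact X -> poly_funs p ->
  exists M : R, forall x, X x -> `|p x| <= M.
Proof.
move=> cX [r _ <-].
(* Boundedness gives a bound by every number above [K], here [K + 1]. *)
have [K [_ /(_ (K + 1))]] := compact_bounded cX.
rewrite ltrDl ltr01 => /(_ isT) KX.
exists (\sum_(m <- r) `|m.1| * \prod_j (K + 1) ^+ m.2 j) => x Xx.
apply: le_trans (ler_norm_sum _ _ _) _; apply: ler_sum => m _.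
rewrite normrM ler_wpM2l// normr_prod; apply: ler_prod => j _.
rewrite normr_ge0/= normrX lerXn2r ?nnegrE//.
  by rewrite (le_trans _ (KX _ Xx)).
apply: le_trans (KX _ Xx); rewrite [leRHS]/Num.norm /= mx_normrE.
by apply/bigmax_geP; right; exists (ord0, j).
Qed.

Lemma poly_deg_leD d (p q : 'rV[R]_n -> R) :
  poly_deg_le d p -> poly_deg_le d q -> poly_deg_le d (fun x => p x + q x).
Proof.
move=> [c cP] [c' cQ]; exists (fun a => c a + c' a) => x.
by rewrite cP cQ -big_split/=; apply: eq_bigr => a _; rewrite mulrDl.
Qed.

Lemma poly_deg_le_monomial d c (k : {ffun 'I_n -> nat}) : (\sum_j k j <= d)%N ->
  poly_deg_le d (fun x : 'rV[R]_n => c * \prod_j x ord0 j ^+ k j).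
Proof.
move=> kd; have kjd j : (k j < d.+1)%N.
  by rewrite ltnS (leq_trans _ kd)// (bigD1 j)//= leq_addr.
pose a0 : {ffun 'I_n -> 'I_d.+1} := [ffun j => Ordinal (kjd j)].
have a0k j : a0 j = k j :> nat by rewrite ffunE.
exists (fun a => if a == a0 then c else 0) => x.
rewrite (bigD1 a0)/=; last by under eq_bigr do rewrite a0k.
rewrite eqxx [X in _ + X]big1 ?addr0; last by move=> a /andP[_ /negbTE ->]; rewrite mul0r.
by congr (_ * _); apply: eq_bigr => j _; rewrite a0k.
Qed.

(** The exponents in [poly_deg_le d] have a type that depends on [d]; covering all large [d] at once
    avoids casts, and is what a limit in [d] asks for. *)
Lemma poly_fun_deg_le r : exists d0, forall d, (d0 <= d)%N -> poly_deg_le d (poly_fun r).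
Proof.
elim: r => [|m r [d0 IH]].
  exists 0%N => d _; exists (fun=> 0) => x.
  by rewrite /poly_fun big_nil big1// => a _; rewrite mul0r.
exists (maxn d0 (\sum_j m.2 j)) => d; rewrite geq_max => /andP[/IH rd md].
rewrite (_ : poly_fun _ = fun x => m.1 * \prod_j x ord0 j ^+ m.2 j + poly_fun r x).
  by apply: poly_deg_leD => //; exact: poly_deg_le_monomial.
by apply/funext => x; rewrite /poly_fun big_cons.
Qed.

(** Half-spaces come from [L2approx_lt], rational boxes as finite intersections, open sets as
    countable unions, Borel sets by generation, and nonnegative functions from [L2approx_ge0]. *)
Lemma poly_fun_L2_dense (mu : {measure set (Borel R n) -> \bar R})
    (X : set 'rV[R]_n) (psi : 'rV[R]_n -> R) :
  compact X -> (mu X < +oo)%E -> isL2 mu X psi -> (forall x, X x -> 0 <= psi x) ->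
  forall e : R, 0 < e ->
    exists r, (sqint mu X (fun x => psi x - poly_fun r x)%R < e%:E)%E.
Proof.
move=> cX muX Lpsi psi0 e e0.
have mX : measurable (X : set (Borel R n)).
  by apply: Borel_closed; apply: compact_closed => //; exact: norm_hausdorff.
have mP p : poly_funs p -> measurable_fun (X : set (Borel R n)) (p : Borel R n -> R).
  exact: measurable_poly_funs.
have bP p := @poly_funs_bounded X p cX.
suff [_ [r _ <-] rP] : exists2 p, poly_funs p &
    (sqint mu X (fun x => psi x - p x)%R < e%:E)%E by exists r.
apply: (L2approx_ge0 mX poly_funs_cst poly_funsD poly_funsM mP bP _ Lpsi psi0) => //.
pose S : set (set (Borel R n)) := L2approx_set mu X poly_funs.
suff oS : @open 'rV[R]_n `<=` S.
  move=> B mB.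
  by have [] := L2approx_generated mX muX poly_funs_cst poly_funsD poly_funsM mP bP oS mB.
have SI A B : S A -> S B -> S (A `&` B).
  exact: (L2approx_setI mX poly_funsM mP bP).
have Slt u (t : R) : poly_funs u -> S [set x | u x < t].
  move=> Pu; apply: (L2approx_lt mX muX poly_funs_cst poly_funsD poly_funsM mP bP) => //.
  have := @measurable_poly_funs [set: Borel R n] u Pu.
  move=> /(_ measurableT _ (measurable_itv `]-oo, t[)).
  by rewrite setTI.
have S0 : S set0 by exact: (L2approx_set0 mu X poly_funs_cst).
move=> U /open_bigcup_rat_box ->.
apply: (L2approx_bigcup mX muX poly_funs_cst poly_funsD poly_funsM mP bP) => k.
case: unpickle => // p; case: ifP => // _; rewrite rat_boxE.
elim/big_ind: _ => //.
- rewrite -setC0; exact: (L2approx_setC mX poly_funs_cst poly_funsD poly_funsM mP bP).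
- move=> j _; apply: SI; apply: Slt; first exact: poly_funs_coord.
  by apply: poly_funsM; [exact: poly_funs_cst|exact: poly_funs_coord].
Qed.

End polynomial_functions.

(** * Varieties, supports and Euclidean neighbourhoods *)

Section varieties.
Context (R : realType) (n : nat).
Implicit Types Z X : set 'rV[R]_n.

Lemma continuous_poly_fun r : continuous (@poly_fun R n r).
Proof.
apply: continuous_big => [|m _]; first exact: add_continuous.
move=> x; apply: continuousM; first exact: cst_continuous.
move: x; apply: continuous_big => [|j _]; first exact: mul_continuous.
move=> x; apply: (@continuous_comp _ _ _ (fun y : 'rV[R]_n => y ord0 j)
  (fun t : R => t ^+ m.2 j)); [exact: coord_continuous|exact: exprn_continuous].
Qed.

Lemma is_poly_funs (p : 'rV[R]_n -> R) : is_poly p -> poly_funs p.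
Proof.
move=> [d [c cP]].
pose mon (a : {ffun 'I_n -> 'I_d.+1}) : R * {ffun 'I_n -> nat} :=
  (c a, [ffun j => (a j : nat)]).
exists [seq mon a | a : {ffun 'I_n -> 'I_d.+1} <- index_enum _ &
                    (\sum_(i < n) (a i : nat) <= d)%N] => //.
apply/funext => x; rewrite cP /poly_fun big_map big_filter; apply: eq_bigr => a _ /=.
by congr (_ * _); apply: eq_bigr => j _; rewrite ffunE.
Qed.

Lemma variety_closed Z : is_variety Z -> closed Z.
Proof.
move=> [k [ps [psP ->]]].
rewrite [X in closed X](_ : _ = \bigcap_(i in [set: 'I_k]) (ps i @^-1` [set y | y = 0])).
  apply: closed_bigI => i _; have [r _ <-] := is_poly_funs (psP i).
  by apply: preimage_closed; [move=> x _; exact: continuous_poly_fun|exact: closed_eq].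
by apply/seteqP; split => [x xP i _|x xP i]; [exact: xP|exact: (xP i I)].
Qed.

(** A point outside the support has an open null neighbourhood, hence a null rational box around it,
    and there are countably many such boxes. Compactness makes the support closed, hence Borel. *)
Lemma msupport_null (mu : {measure set (Borel R n) -> \bar R}) :
  compact (msupport mu) -> mu (~` msupport mu) = 0.
Proof.
set X := msupport mu => cX.
have clX : closed X by apply: compact_closed => //; exact: norm_hausdorff.
have mXc : measurable (~` X : set (Borel R n)) by apply: measurableC; exact: Borel_closed.
apply: measure_negligible => //.
pose B k : set (Borel R n) := if @unpickle ('rV[rat]_n * 'rV[rat]_n)%type k is Some p
  then (if `[< mu.-negligible (rat_box p : set (Borel R n)) >] then rat_box p else set0)
  else set0.
apply: (@negligibleS _ _ _ mu (\bigcup_k B k)); last first.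
  apply: negligible_bigcup => k; rewrite /B; case: unpickle => [p|]; last exact: negligible_set0.
  by case: asboolP => // _; exact: negligible_set0.
move=> x /existsNP[U /not_implyP[oU /not_implyP[Ux U0]]].
have [p [px pU]] := open_rat_box oU Ux.
have nU : mu.-negligible (rat_box p : set (Borel R n)).
  exists U; split => //; first exact: Borel_open.
  apply/eqP; rewrite eq_le measure_ge0 andbT leNgt; exact/negP.
by exists (pickle p) => //; rewrite /B pickleK; case: asboolP.
Qed.

Lemma measurable_enorm_gt (x : 'rV[R]_n) (delta : R) : 0 < delta ->
  measurable ([set y | delta < enorm (y - x)] : set (Borel R n)).
Proof.
move=> d0; pose s (y : 'rV[R]_n) := \sum_(i < n) (y - x) ord0 i ^+ 2.
have ms : measurable_fun [set: Borel R n] (s : Borel R n -> R).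
  apply: measurable_sum => i; apply: measurable_funX.
  under eq_fun do rewrite !mxE.
  by apply: measurable_funB => //; exact: measurable_coord.
have := ms measurableT _ (measurable_itv `]delta ^+ 2, +oo[); rewrite setTI.
rewrite (_ : s @^-1` _ = [set y | delta < enorm (y - x)])//.
have s0 y : 0 <= s y by apply: sumr_ge0 => i _; exact: sqr_ge0.
apply/seteqP; split => y /=; rewrite in_itv/= andbT /enorm -/(s y) => dy.
  rewrite -(ger0_norm (ltW d0)) -sqrtr_sqr ltr_sqrt//.
  by rewrite (le_lt_trans _ dy)// sqr_ge0.
by rewrite -(sqr_sqrtr (s0 y)) ltr_pXn2r// nnegrE ?sqrtr_ge0// ltW.
Qed.

Lemma coord_le_enorm (y : 'rV[R]_n) j : `|y ord0 j| <= enorm y.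
Proof.
rewrite -sqrtr_sqr ler_sqrt; last by apply: sumr_ge0 => i _; exact: sqr_ge0.
by rewrite (bigD1 j)//= lerDl; apply: sumr_ge0 => i _; exact: sqr_ge0.
Qed.

(** The topology of ['rV[R]_n] is that of the maximum norm, whereas mollifiers concentrate in
    Euclidean distance. Halving the radius absorbs the large inequality. *)
Lemma nbhs_enorm (x : 'rV[R]_n) (U : set 'rV[R]_n) : nbhs x U ->
  exists2 delta, 0 < delta & forall y, enorm (y - x) <= delta -> U y.
Proof.
move=> /nbhs_ballP[e /= e0 eU]; exists (e / 2); first by rewrite divr_gt0.
move=> y yx; apply: eU; split => // i j; rewrite (ord1 i) /ball/=.
have := le_trans (coord_le_enorm (y - x) j) yx; rewrite !mxE distrC; lra.
Qed.

End varieties.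

(** * Averages against concentrating mollifiers *)

Section mollifier_average.
Context (R : realType) (n : nat) (lam : {measure set (Borel R n) -> \bar R}).
Variable Z : set 'rV[R]_n.
Hypothesis mZ : measurable (Z : set (Borel R n)).

Lemma L2norm_sqr (g : 'rV[R]_n -> R) : L2norm lam Z g ^+ 2 = ip lam Z g g.
Proof.
rewrite sqr_sqrtr; last first.
  by apply: fine_ge0; apply: integral_ge0 => y _; rewrite lee_fin sqr_ge0.
by congr fine; apply: eq_integral => y _; rewrite expr2.
Qed.

(** [fine] sends [+oo] to [0], so a positive norm excludes an infinite integral; the lower bound [c]
    on the norms of mollifiers thus makes them square-integrable. *)
Lemma L2norm_gt0_isL2 (g : 'rV[R]_n -> R) :
  measurable_fun (Z : set (Borel R n)) (g : Borel R n -> R) ->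
  0 < L2norm lam Z g -> isL2 lam Z g.
Proof.
move=> mg; rewrite /L2norm sqrtr_gt0 => g0; split => //.
rewrite ltey; apply/eqP => goo.
by move: g0; rewrite -/(sqint lam Z g) goo ltxx.
Qed.

(** Pointwise on [Z], [|F - c|] is at most [eta] plus [K] times the indicator of [S]; this is
    integrated against [g^2]. [S] will be the set of points far from the base point. *)
Lemma ip_near_far (g F : 'rV[R]_n -> R) (c K eta : R) (S : set 'rV[R]_n) :
  isL2 lam Z g -> measurable (S : set (Borel R n)) ->
  measurable_fun (Z : set (Borel R n)) (F : Borel R n -> R) ->
  0 <= eta -> (forall y, Z y -> `|F y - c| <= K) ->
  (forall y, Z y -> ~ S y -> `|F y - c| <= eta) ->
  `|ip lam Z g (fun y => F y * g y) - c * ip lam Z g g| <=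
    eta * ip lam Z g g + K * fine (\int[lam]_(y in Z `&` S) (g y ^+ 2)%:E)%E.
Proof.
move=> Lg mS mF eta0 FK Feta.
have mFc : measurable_fun (Z : set (Borel R n)) ((fun y => F y - c) : Borel R n -> R).
  exact: measurable_funB.
have LF : isL2 lam Z (fun y => (F y - c) * g y) by exact: (isL2_mul_bounded mZ mFc FK Lg).
have mi : measurable_fun (Z : set (Borel R n)) (\1_S : Borel R n -> R).
  exact: measurable_indic.
have LS : isL2 lam Z (fun y => \1_S y * g y).
  by apply: (@isL2_mul_bounded _ _ _ lam _ mZ _ _ 1) => // y _; exact: normr_indic_le1.
have -> : ip lam Z g (fun y => F y * g y) - c * ip lam Z g g =
    ip lam Z g (fun y => (F y - c) * g y).
  apply/eqP; rewrite subr_eq; apply/eqP.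
  rewrite -ipZr// -ipDr//; last exact: isL2Z.
  by apply: eq_ip => // y _; ring.
have -> : fine (\int[lam]_(y in Z `&` S) (g y ^+ 2)%:E)%E =
    ip lam Z g (fun y => \1_S y * g y).
  rewrite -[LHS]/(\int[lam]_(y in Z `&` S) (g y ^+ 2))%R Rintegral_mkcondr.
  apply: eq_Rintegral => y _; rewrite /patch indicE.
  by case: (y \in S); rewrite ?mul1r ?expr2// mul0r mulr0.
have LD : isL2 lam Z (fun y => eta * g y + K * (\1_S y * g y)).
  by apply: isL2D => //; exact: isL2Z.
rewrite -!ipZr// -ipDr//; try exact: isL2Z.
apply: le_trans (le_normr_Rintegral mZ (L2_integrableM mZ Lg LF)) _.
apply: le_Rintegral => //.
- exact: integrable_norm (L2_integrableM mZ Lg LF).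
- exact: L2_integrableM.
move=> y Zy; rewrite normrM normrM.
have -> : `|g y| * (`|F y - c| * `|g y|) = `|F y - c| * g y ^+ 2.
  by rewrite mulrCA -expr2 -normrX (ger0_norm (sqr_ge0 (g y))).
have -> : g y * (eta * g y + K * (\1_S y * g y)) = (eta + K * \1_S y) * g y ^+ 2 by ring.
apply: ler_wpM2r; first exact: sqr_ge0.
rewrite indicE; have [yS|nS] := boolP (y \in S).
  by rewrite /= mulr1 (le_trans (FK _ Zy))// lerDr.
by rewrite /= mulr0 addr0; apply: Feta => // Sy; rewrite mem_set in nS.
Qed.

Lemma mollifier_average (E : set R) (phi : R -> 'rV[R]_n -> R) (x : 'rV[R]_n)
    (F : 'rV[R]_n -> R) (c K : R) :
  (forall eps, E eps -> isL2 lam Z (phi eps) /\ 0 < L2norm lam Z (phi eps)) ->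
  (forall delta : R, 0 < delta ->
     (fun eps =>
        fine (\int[lam]_(y in Z `&` [set y | (delta < enorm (y - x))%R])
                ((phi eps y) ^+ 2)%:E)%E / (L2norm lam Z (phi eps)) ^+ 2)
       @ within E (nbhs (0 : R)) --> (0 : R)) ->
  measurable_fun (Z : set (Borel R n)) (F : Borel R n -> R) ->
  (forall y, Z y -> `|F y - c| <= K) ->
  (forall eta : R, 0 < eta -> exists2 delta : R, 0 < delta &
     forall y, Z y -> enorm (y - x) <= delta -> `|F y - c| <= eta) ->
  (fun eps => ip lam Z (phi eps) (fun y => F y * phi eps y)
              / (L2norm lam Z (phi eps)) ^+ 2)
    @ within E (nbhs (0 : R)) --> c.
Proof.
move=> Lphi tail mF FK Fx; apply/cvgrPdist_le => eta eta0.
have eta2 : 0 < eta / 2 by rewrite divr_gt0.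
(* [|K| + 1] replaces [K] in order to divide by it: the far part then costs at most [eta / 2] times
   [N], as does the near part. *)
have K1 : 0 < `|K| + 1 by rewrite ltr_wpDl.
have [delta d0 Fd] := Fx _ eta2.
have e0 : 0 < eta / 2 / (`|K| + 1) by rewrite divr_gt0.
have /cvgrPdist_le/(_ _ e0) := tail _ d0.
apply: filterS2 (near_withinT E _) => eps Eeps.
have [Lg g0] := Lphi _ Eeps; set N := L2norm _ _ _ ^+ 2.
have N0 : 0 < N by rewrite exprn_gt0.
set t := fine _; rewrite sub0r normrN => tN.
have := @ip_near_far (phi eps) F c (`|K| + 1) (eta / 2) _ Lg
  (measurable_enorm_gt x d0) mF (ltW eta2).
rewrite -L2norm_sqr -/N -/t => /(_ _ _) h.
have {h} : `|ip lam Z (phi eps) (fun y => F y * phi eps y) - c * N| <=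
    eta / 2 * N + (`|K| + 1) * t.
  apply: h => y Zy; first by rewrite (le_trans (FK _ Zy))// (le_trans (ler_norm K))// lerDl.
  by move=> /negP; rewrite -leNgt => /Fd; apply.
have tN' : (`|K| + 1) * t <= eta / 2 * N.
  have := le_trans (ler_norm _) tN.
  by rewrite ler_pdivrMr// mulrAC ler_pdivlMr// mulrC.
set I := ip _ _ _ _ => IN.
rewrite distrC; have -> : I / N - c = (I - c * N) / N by rewrite mulrBl mulfK ?gt_eqF.
rewrite normrM normfV (gtr0_norm N0) ler_pdivrMr//.
by apply: le_trans IN _; lra.
Qed.

End mollifier_average.

(** * The density-estimator kernel *)

Section conull.
Context d (T : measurableType d) (R : realType) (mu : {measure set T -> \bar R}).
Import HBNNSimple.

(* [g] need not be measurable: elements of [V_d] are constrained on [Z] only, so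
   [dens_rep] may be any function off [Z].  The integral of such a [g >= 0] is a
   supremum over the simple functions below [g]. *)
Lemma ge0_integral_conull (D : set T) (g : T -> \bar R) : measurable D ->
  mu (~` D) = 0%E -> (forall x, (0 <= g x)%E) ->
  (\int[mu]_x g x = \int[mu]_(x in D) g x)%E.
Proof.
move=> mD D0 g0; rewrite ge0_integralTE// ge0_integralE//.
apply/eqP; rewrite eq_le; apply/andP; split.
  apply: ge_ereal_sup => _ [h hg <-].
  rewrite -integralT_nnsfun (@ge0_negligible_integral _ _ _ _ _ (~` D))//.
  - rewrite setTD setCK integral_nnsfun// mrestrict.
    apply: ereal_sup_ubound; exists (proj_nnsfun h mD) => // x.
    rewrite -(mrestrict h mD) /patch; case: ifP => // _; exact: hg.
  - exact: measurableC.
  - by apply/measurable_EFinP; exact: measurable_funTS.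
  - by move=> x _; rewrite lee_fin.
apply: le_ereal_sup => _ [h hg <-]; exists h => // x.
by apply: le_trans (hg x) _; rewrite /patch; case: ifP.
Qed.

End conull.

Section DMCD.
Context (R : realType) (n : nat) (lam mu : {measure set (Borel R n) -> \bar R}).
Variables (Z X : set 'rV[R]_n) (phi : 'rV[R]_n -> R -> 'rV[R]_n -> R).
Variables (f : 'rV[R]_n -> R) (m : R).
Hypotheses (clZ : closed Z) (XZ : X `<=` Z) (cX : compact X).
Hypotheses (mu_conull : mu (~` X) = 0%E) (mufin : (mu [set: Borel R n] < +oo)%E).
Hypotheses (cf : {within X, continuous f}) (m0 : 0 < m).
Hypothesis fm : forall y, X y -> m <= f y.
Hypothesis fdens : has_density_on lam mu X f.

(* [1 / f] on [X]; the truncation keeps it bounded and positive off [X]. *)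
Definition inv_dens y : R := (Num.max (f y) m)^-1.

Lemma inv_densE y : X y -> inv_dens y = (f y)^-1.
Proof. by move=> Xy; rewrite /inv_dens max_l// fm. Qed.

Lemma inv_dens_gt0 y : 0 < inv_dens y.
Proof. by rewrite invr_gt0 lt_max m0 orbT. Qed.

Lemma inv_dens_le y : inv_dens y <= m^-1.
Proof. by rewrite lef_pV2 ?posrE ?lt_max ?m0 ?orbT// le_max lexx orbT. Qed.

Lemma density_support_closed : closed X.
Proof. by apply: compact_closed => //; exact: norm_hausdorff. Qed.

Let mX : measurable (X : set (Borel R n)).
Proof. exact: Borel_closed density_support_closed. Qed.

Let mZ : measurable (Z : set (Borel R n)).
Proof. exact: Borel_closed clZ. Qed.

Lemma inv_dens_continuous : {within X, continuous inv_dens}.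
Proof.
apply: (@within_continuous_comp _ _ _ X f (fun t => (Num.max t m)^-1)) => //.
move=> t _; apply: (@cvgV R R (nbhs t) _ (fun t => Num.max t m)); first by rewrite gt_eqF// lt_max m0 orbT.
apply: (@continuous_max R _ id (fun=> m)); first exact: cvg_id.
exact: cst_continuous.
Qed.

Lemma measurable_inv_dens :
  measurable_fun (X : set (Borel R n)) (inv_dens : Borel R n -> R).
Proof. exact: (within_continuous_measurable density_support_closed inv_dens_continuous). Qed.

Let mf : measurable_fun (X : set (Borel R n)) (f : Borel R n -> R).
Proof. exact: (within_continuous_measurable density_support_closed cf). Qed.

Let f0 y : X y -> 0 <= f y.
Proof. by move=> /fm; apply: le_trans; exact: ltW. Qed.

Let muX : (mu X < +oo)%E.
Proof. by apply: le_lt_trans mufin; apply: le_measure; rewrite ?inE. Qed.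

Section fixed_point.
Variables (x : 'rV[R]_n) (eps : R).
Notation phix := (phi x eps).
Hypothesis Lphi : isL2 lam Z phix.
Hypothesis phi0 : forall y, Z y -> 0 <= phix y.

Let LphiX : isL2 lam X phix.
Proof.
have [mphi Lf] := Lphi; split; first exact: measurable_funS mphi.
apply: le_lt_trans Lf; apply: ge0_subset_integral => //.
- exact: measurable_sqr.
- by move=> y _; rewrite lee_fin sqr_ge0.
Qed.

Definition dens_ratio y := inv_dens y * phix y.

(** On [X], [(phi / f)^2 dmu = (phi^2 / f) dlam], which is at most [m^-1 phi^2 dlam]. *)
Lemma isL2_dens_ratio : isL2 mu X dens_ratio.
Proof.
have [mphi Lf] := LphiX.
have mr : measurable_fun (X : set (Borel R n)) (dens_ratio : Borel R n -> R).
  by apply: measurable_funM => //; exact: measurable_inv_dens.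
split => //; rewrite /sqint (ge0_integral_density mX mf f0 fdens); last 2 first.
- exact: measurable_funX.
- by move=> y _; exact: sqr_ge0.
apply: le_lt_trans (_ : ((m^-1)%:E * sqint lam X phix < +oo)%E); last first.
  by apply: lte_mul_pinfty => //; rewrite lee_fin invr_ge0 ltW.
rewrite /sqint -ge0_integralZl_EFin//; last 3 first.
- by move=> y _; rewrite lee_fin sqr_ge0.
- exact: measurable_sqr.
- by rewrite invr_ge0 ltW.
apply: ge0_le_integral => //.
- by move=> y Xy; rewrite lee_fin mulr_ge0 ?sqr_ge0// f0.
- by apply/measurable_EFinP; apply: measurable_funM => //; exact: measurable_funX.
- by apply: measurable_funeM; exact: measurable_sqr.
move=> y Xy; rewrite -EFinM lee_fin /dens_ratio.
have fy : f y != 0 by rewrite gt_eqF// (lt_le_trans m0)// fm.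
have -> : (inv_dens y * phix y) ^+ 2 * f y = inv_dens y * phix y ^+ 2.
  by rewrite inv_densE//; field.
by apply: ler_wpM2r; [exact: sqr_ge0|exact: inv_dens_le].
Qed.

Lemma integral_phi_ip p : isL2 mu X p ->
  (\int[lam]_(y in (X : set (Borel R n))) (phix y * p y)%:E = (ip mu X dens_ratio p)%:E)%E.
Proof.
move=> [mp Lp]; have Lr := isL2_dens_ratio; have [mr _] := Lr.
rewrite EFin_ip// (integral_density mX mf f0 fdens); last exact: measurable_funM.
apply: eq_integral => y; rewrite inE => Xy; congr EFin.
have fy : f y != 0 by rewrite gt_eqF// (lt_le_trans m0)// fm.
by rewrite /dens_ratio inv_densE//; field.
Qed.

(** [dens_ratio] is its own test function in [integral_phi_ip]; extending [1 / f] by [0] turns the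
    integral over [X] into one over [Z], where the mollifiers are normalised. *)
Lemma ip_dens_ratio : ip mu X dens_ratio dens_ratio =
  ip lam Z phix (fun y => (inv_dens \_ X) y * phix y).
Proof.
apply: EFin_inj; rewrite -integral_phi_ip; last exact: isL2_dens_ratio.
have [mphi _] := Lphi.
have Lh : isL2 lam Z (fun y => (inv_dens \_ X) y * phix y).
  apply: (@isL2_mul_bounded _ _ _ _ _ mZ _ _ m^-1) => //.
    apply/(measurable_restrict _ mX mZ).
    apply: measurable_funS measurable_inv_dens => //; exact: subIsetr.
  move=> y _; rewrite /patch; case: ifP => _.
    by rewrite gtr0_norm ?inv_dens_gt0// inv_dens_le.
  by rewrite normr0 invr_ge0 ltW.
rewrite (EFin_ip mZ Lphi Lh) -{1}(setIidr XZ) integral_mkcondr.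
apply: eq_integral => y _; rewrite /patch /dens_ratio.
by case: (y \in X) => //; rewrite mul0r mulr0.
Qed.

(** Exponents of excessive degree give the zero function, so that the family is indexed by a whole
    finite type, as [L2_projection] requires. *)
Definition monomial_upto (k : nat) (a : {ffun 'I_n -> 'I_k.+1}) (y : 'rV[R]_n) : R :=
  if (\sum_(i < n) (a i : nat) <= k)%N then \prod_(i < n) y ord0 i ^+ a i else 0.

Lemma poly_deg_leE k (p : 'rV[R]_n -> R) : poly_deg_le k p <->
  exists c, forall y, p y = \sum_a c a * @monomial_upto k a y.
Proof.
have E c y : \sum_a c a * @monomial_upto k a y =
    \sum_(a : {ffun 'I_n -> 'I_k.+1} | (\sum_(i < n) (a i : nat) <= k)%N)
       c a * \prod_(i < n) y ord0 i ^+ a i.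
  rewrite [RHS]big_mkcond; apply: eq_bigr => a _.
  by rewrite /monomial_upto; case: ifP => // _; rewrite mulr0.
by split => -[c cP]; exists c => y; rewrite cP E.
Qed.

Lemma isL2_poly p : poly_funs p -> isL2 mu X p.
Proof.
move=> Pp; have [M pM] := poly_funs_bounded cX Pp.
apply: (isL2_bounded mX muX _ pM); exact: measurable_poly_funs.
Qed.

Lemma isL2_monomial k a : isL2 mu X (@monomial_upto k a).
Proof.
apply/isL2_poly/is_poly_funs; exists k; apply/poly_deg_leE.
exists (fun b => (b == a)%:R) => y.
by rewrite (bigD1 a)//= eqxx mul1r big1 ?addr0// => b /negbTE ->; rewrite mul0r.
Qed.

Lemma eq_isL2 g g' : (forall y, X y -> g y = g' y) -> isL2 mu X g' -> isL2 mu X g.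
Proof.
move=> gg' [mg Lg]; split; last by rewrite (eq_sqint mu gg').
by apply: eq_measurable_fun mg => y; rewrite inE => /gg' ->.
Qed.

Lemma isL2_inVd k g : inVd Z k g -> isL2 mu X g.
Proof.
move=> [P [Pk gP]]; apply: (@eq_isL2 _ P) => [y /XZ/gP//|].
by apply/isL2_poly/is_poly_funs; exists k.
Qed.

Lemma is_dens_repE k g : is_dens_rep lam mu Z X phi k eps x g <->
  inVd Z k g /\ forall p, inVd Z k p -> ip mu X dens_ratio p = ip mu X g p.
Proof.
split=> -[gV gP]; split => // p pV; have Lp := isL2_inVd pV; have Lg := isL2_inVd gV.
  apply: EFin_inj; rewrite (EFin_ip mX Lg Lp) -integral_phi_ip//; exact: gP.
by rewrite integral_phi_ip// gP// EFin_ip.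
Qed.

(** [xget] returns its default [0] unless a representative exists; one is built by projecting
    [dens_ratio] onto the span of the monomials. *)
Lemma dens_repP k :
  is_dens_rep lam mu Z X phi k eps x (dens_rep lam mu Z X phi k eps x).
Proof.
apply: xgetPex.
have Le a := isL2_monomial a : isL2 mu X (@monomial_upto k a).
have [c cP] := L2_projection mX Le isL2_dens_ratio.
exists (fun y => \sum_a c a * @monomial_upto k a y); apply/is_dens_repE; split.
  by exists (fun y => \sum_a c a * @monomial_upto k a y); split => //;
     apply/poly_deg_leE; exists c.
move=> p [P [/poly_deg_leE[c' Pc'] pP]].
have Lc : isL2 mu X (fun y => \sum_a c a * @monomial_upto k a y).
  by apply: isL2_sum => // a; exact: isL2Z.
have E g : isL2 mu X g ->
    ip mu X g p = \sum_a c' a * ip mu X (@monomial_upto k a) g.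
  move=> Lg; rewrite ipC; transitivity
      (ip mu X (fun y => \sum_a c' a * @monomial_upto k a y) g).
    by apply: eq_ip => // y /XZ/pP ->.
  rewrite ip_suml//; last by move=> a; exact: isL2Z.
  by apply: eq_bigr => a _; rewrite ipZl.
rewrite !E//; last exact: isL2_dens_ratio.
by apply: eq_bigr => a _; rewrite ipC -cP ipC.
Qed.

Lemma DMCDE k : DMCD lam mu Z X phi k eps x x =
  ip mu X (dens_rep lam mu Z X phi k eps x) (dens_rep lam mu Z X phi k eps x).
Proof.
congr fine; apply: (ge0_integral_conull mX mu_conull) => y.
by rewrite lee_fin -expr2 sqr_ge0.
Qed.

(** For the projection [g], [|dens_ratio|^2 - |g|^2 = |dens_ratio - g|^2], which is at most the
    squared distance to any polynomial of degree at most [k]; density makes the latter small. *)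
Lemma DMCD_cvg : (fun k => DMCD lam mu Z X phi k eps x x) @ \oo -->
  ip mu X dens_ratio dens_ratio.
Proof.
have Lr := isL2_dens_ratio.
have r0 y : X y -> 0 <= dens_ratio y.
  by move=> Xy; apply: mulr_ge0; [exact/ltW/inv_dens_gt0|exact/phi0/XZ].
apply/cvgrPdist_le => e e0.
have [r rP] := poly_fun_L2_dense cX muX Lr r0 e0.
have [k0 kP] := poly_fun_deg_le r.
exists k0 => // k /= /kP rk; rewrite DMCDE.
have /is_dens_repE[gV gP] := dens_repP k.
set g := dens_rep _ _ _ _ _ _ _ _ in gV gP *.
have Lg := isL2_inVd gV.
have pV : inVd Z k (poly_fun r) by exists (poly_fun r).
have Lp := isL2_inVd pV.
have [P [Pk gPZ]] := gV.
have LB := isL2B mX Lr Lg.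
have orth q : inVd Z k q -> ip mu X (fun y => dens_ratio y - g y) q = 0.
  by move=> qV; rewrite ipBl ?gP ?subrr//; exact: isL2_inVd qV.
have E1 : ip mu X dens_ratio dens_ratio =
    ip mu X (fun y => dens_ratio y - g y) (fun y => dens_ratio y - g y) + ip mu X g g.
  rewrite -(ip_pythagoras mX LB Lg (orth _ gV)).
  by apply: eq_ip => y _; rewrite subrK.
have gpV : inVd Z k (fun y => g y + (-1) * poly_fun r y).
  have /poly_deg_leE[c cP] := Pk; have /poly_deg_leE[c' c'P] := rk.
  exists (fun y => P y + (-1) * poly_fun r y); split; last by move=> y Zy; rewrite gPZ.
  apply/poly_deg_leE; exists (fun a => c a - c' a) => y.
  rewrite cP c'P mulN1r -sumrB; apply: eq_bigr => a _; by rewrite mulrBl.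
(* A second use of Pythagoras: [g - poly_fun r] is in [V_k], hence orthogonal to
   [dens_ratio - g]. *)
have E2 : ip mu X (fun y => dens_ratio y - poly_fun r y)
                  (fun y => dens_ratio y - poly_fun r y) =
    ip mu X (fun y => dens_ratio y - g y) (fun y => dens_ratio y - g y) +
    ip mu X (fun y => g y + (-1) * poly_fun r y) (fun y => g y + (-1) * poly_fun r y).
  rewrite -(ip_pythagoras mX LB (isL2_inVd gpV) (orth _ gpV)).
  by apply: eq_ip => y _; ring.
rewrite E1 addrK ger0_norm ?ipxx_ge0//.
have : ip mu X (fun y => dens_ratio y - poly_fun r y)
               (fun y => dens_ratio y - poly_fun r y) < e.
  by rewrite -lte_fin EFin_ipxx//; exact: isL2B.
rewrite E2 => /ltW; apply: le_trans; rewrite lerDl; exact: ipxx_ge0.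
Qed.

End fixed_point.

(** Treats both cases of the theorem at once: the last hypothesis says that [1 / f], extended by
    [0], tends to [c] at [x] along [Z]. *)
Lemma DMCD_mollifier_limit (E : set R) (x : 'rV[R]_n) (c : R) :
  (forall eps, E eps -> isL2 lam Z (phi x eps) /\ 0 < L2norm lam Z (phi x eps)) ->
  (forall eps, E eps -> forall y, Z y -> 0 <= phi x eps y) ->
  (forall delta : R, 0 < delta ->
     (fun eps =>
        fine (\int[lam]_(y in Z `&` [set y | (delta < enorm (y - x))%R])
                ((phi x eps y) ^+ 2)%:E)%E / (L2norm lam Z (phi x eps)) ^+ 2)
       @ within E (nbhs (0 : R)) --> (0 : R)) ->
  (forall eta : R, 0 < eta -> exists2 delta : R, 0 < delta &
     forall y, Z y -> enorm (y - x) <= delta -> `|(inv_dens \_ X) y - c| <= eta) ->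
  exists L : R -> R,
    (forall eps, E eps ->
       (fun d : nat => DMCD lam mu Z X phi d eps x x
                       / (L2norm lam Z (phi x eps)) ^+ 2)
         @ \oo --> L eps) /\
    L @ within E (nbhs (0 : R)) --> c.
Proof.
move=> Lphi phi0 tail Fc.
exists (fun eps => ip lam Z (phi x eps) (fun y => (inv_dens \_ X) y * phi x eps y)
                   / (L2norm lam Z (phi x eps)) ^+ 2); split.
  move=> eps Eeps; have [Lp _] := Lphi _ Eeps.
  apply: cvgM; last exact: cvg_cst.
  by rewrite -ip_dens_ratio//; apply: DMCD_cvg => //; exact: phi0.
have mF : measurable_fun (Z : set (Borel R n)) ((inv_dens \_ X) : Borel R n -> R).
  apply/(measurable_restrict _ mX mZ).
  apply: measurable_funS measurable_inv_dens => //; exact: subIsetr.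
(* The averaged function lies between [0] and [m^-1], hence the bound [m^-1 + |c|] on its distance
   to [c]. *)
refine (@mollifier_average R n lam Z mZ E (phi x) x (inv_dens \_ X) c (m^-1 + `|c|)
  Lphi tail mF _ Fc).
move=> y _; apply: le_trans (ler_normB _ _) _; rewrite lerD2r /patch.
case: ifP => _; last by rewrite normr0 invr_ge0 ltW.
by rewrite gtr0_norm ?inv_dens_gt0// inv_dens_le.
Qed.

End DMCD.

(** * The limit at relative interior points and off the support *)

Unset Implicit Arguments.

Theorem theorem3p3 (R : realType) (n : nat) (Z : set 'rV[R]_n)
  (lam : {measure set (Borel R n) -> \bar R}) (E : set R)
  (phi : 'rV[R]_n -> R -> 'rV[R]_n -> R)
  (mu : {measure set (Borel R n) -> \bar R}) (X : set 'rV[R]_n)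
  (f : 'rV[R]_n -> R) :
  is_variety Z ->
  L2_mollifiers lam Z E phi ->
  (mu [set: Borel R n] < +oo)%E ->
  mu (~` Z) = 0%E ->
  X = msupport mu ->
  compact X ->
  rel_interior Z X !=set0 ->
  zariski_dense Z X ->
  {within X, continuous f} ->
  (forall x, X x -> 0 < f x) ->
  has_density_on lam mu X f ->
  (forall x, rel_interior Z X x ->
     exists L : R -> R,
       (forall eps, E eps ->
          (fun d : nat => DMCD lam mu Z X phi d eps x x
                          / (L2norm lam Z (phi x eps)) ^+ 2)
            @ \oo --> L eps) /\
       L @ within E (nbhs (0 : R)) --> (f x)^-1) /\
  (forall x, Z x -> ~ X x ->
     exists L : R -> R,
       (forall eps, E eps ->
          (fun d : nat => DMCD lam mu Z X phi d eps x x
                          / (L2norm lam Z (phi x eps)) ^+ 2)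
            @ \oo --> L eps) /\
       L @ within E (nbhs (0 : R)) --> (0 : R)).
Proof.
move=> /variety_closed clZ [_ phiP Lbd _ tail] mufin muZ XE cX [x0 [Xx0 _]] _ cf fpos fdens.
(* The complement of [Z] is open and null, so it contains no point of the support. *)
have XZ : X `<=` Z.
  move=> x; rewrite XE => Xx; apply: contrapT => nZx.
  by have := Xx _ (closed_openC clZ) nZx; rewrite muZ ltxx.
have mu_conull : mu (~` X) = 0%E by move: cX; rewrite XE; exact: msupport_null.
(* The minimum of [f] on [X] serves as the lower bound [m]; the relative interior point shows that
   [X] is nonempty. *)
have [z zX fz] := compact_EVT_min (ex_intro _ x0 Xx0) cX cf.
have m0 : 0 < f z by apply: fpos; rewrite -in_setE.
have fm y : X y -> f z <= f y by move=> Xy; apply: fz; rewrite in_setE.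
have Lphi x : Z x -> forall eps, E eps ->
    isL2 lam Z (phi x eps) /\ 0 < L2norm lam Z (phi x eps).
  move=> Zx eps Eeps; have [mphi _ _] := phiP _ _ Zx Eeps.
  have [c [C [c0 [_ /(_ _ Zx)[cN _]]]]] := Lbd _ Eeps.
  have N0 := lt_trans c0 cN; split => //.
  by apply: L2norm_gt0_isL2.
have phi0 x : Z x -> forall eps, E eps -> forall y, Z y -> 0 <= phi x eps y.
  by move=> Zx eps Eeps; have [_] := phiP _ _ Zx Eeps.
have lim x c : Z x -> _ := fun Zx => @DMCD_mollifier_limit R n lam mu Z X phi f (f z)
  clZ XZ cX mu_conull mufin cf m0 fm fdens E x c (Lphi x Zx) (phi0 x Zx)
  (fun delta => tail x delta Zx).
split=> [x [Xx [U [oU Ux UX]]]|x Zx nXx]; apply: lim => //; first exact: XZ.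
(* [inv_dens] is continuous within [X] only; intersecting with [U] forces the nearby points of [Z]
   into [X]. *)
- move=> eta eta0; have := inv_dens_continuous cf m0.
  move=> /subspace_continuousP/(_ _ Xx)/cvgrPdist_le/(_ _ eta0) hx.
  have [delta d0 dP] := nbhs_enorm (filterI (open_nbhs_nbhs (conj oU Ux)) hx).
  exists delta => // y Zy /dP[Uy hy]; have Xy : X y by exact: UX.
  by rewrite /patch mem_set// -(inv_densE fm Xx) distrC; exact: hy.
(* [X] is closed, so the extension by [0] vanishes identically near [x]. *)
- move=> eta eta0.
  have nX : nbhs x (~` X).
    by apply: open_nbhs_nbhs; split => //; apply: closed_openC; exact: density_support_closed cX.
  have [delta d0 dP] := nbhs_enorm nX.
  exists delta => // y Zy /dP nXy.
  by rewrite /patch memNset// subr0 normr0 ltW.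
Qed.
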